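(* For $1\le i\le k$ define $D_i$ on left $\mathcal A_\hbar[x_1,\dots,x_n]$-linear combinations of the elements $\overline T_\nu$ ($\nu\subseteq(n-k)^k$) by $D_i(g\,\overline T_\mu)=g\,D_i(\overline T_\mu)$ for $g\in\mathcal A_\hbar[x_1,\dots,x_n]$ and $$D_i(\overline T_\mu)=x_{\mu_i+k+1-i}\,\overline T_\mu+\sum_\lambda\bigl(\hbar-(p-q)x_{\mathtt h(\mu/\lambda)}\bigr)p^{\operatorname{ht}(\mu/\lambda)-1}q^{\operatorname{wd}(\mu/\lambda)-1}\,\overline T_\lambda,$$ the sum over $\lambda\subseteq(n-k)^k$ such that $\mu/\lambda$ is a ribbon with head in row $i$. Then for $\mu\subseteq(n-k)^k$ and $0\le r\le k$, in $\widehat H_n$, $$\overline T_\mu\,e_r(x_1,\dots,x_k)=\sum_{1\le i_1<\cdots<i_r\le k}D_{i_1}\bigl(D_{i_2}(\cdots D_{i_r}(\overline T_\mu)\cdots)\bigr).$$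
   Context: $\mathcal A_\hbar=\mathbb Q[p,q,\hbar]$; $\widehat H_n$ is generated by $T_1,\dots,T_{n-1},x_1,\dots,x_n$ with $(T_i+p)(T_i-q)=0$, braid relations, $x_ix_j=x_jx_i$, $T_ix_j=x_jT_i$ ($j\ne i,i+1$), $T_ix_i=x_{i+1}T_i+(\hbar-(p-q)x_i)$, $T_ix_{i+1}=x_iT_i-(\hbar-(p-q)x_i)$. $\overline T_i=T_i+p-q$, $\overline T_w$ via reduced words. For $\nu\subseteq(n-k)^k$, $w_\nu$ is the permutation with $w_\nu(k+1-i)=\nu_i+k+1-i$ ($1\le i\le k$), increasing on $\{k+1,\dots,n\}$. $[m]=(p^m-q^m)/(p-q)$, $[m]!=\prod_{j\le m}[j]$, $d=\binom k2+\binom{n-k}2$, $\Sigma^n_k=\frac1{[k]![n-k]!}\sum_{v\in S_k\times S_{n-k}}q^{d-\ell(v)}\overline T_v$ (scalars extended to invert $[k]![n-k]!$), $\overline T_\nu=\overline T_{w_\nu}\Sigma^n_k$. Ribbon: nonempty connected skew shape $\mu/\lambda$ with no $2\times2$ square; head = top-right box; $\operatorname{ht},\operatorname{wd}$ = numbers of rows, columns; head in row $i$ gives $\mathtt h(\mu/\lambda)=\mu_i+k+1-i$. *)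

(* Defs.v *)
From HB Require Import structures.
From mathcomp Require Import all_boot all_order all_algebra.
From Stdlib Require Import ClassicalEpsilon.
Set Implicit Arguments. Unset Strict Implicit. Unset Printing Implicit Defensive.
Import Order.TTheory GRing.Theory.
Local Open Scope ring_scope.

Definition isb (P : Prop) : bool :=
  if excluded_middle_informative P then true else false.

(* A permutation w of {1..n} is the sequence [:: w(1); ...; w(n)].
   Products of permutations are compositions of functions. *)

(* w s_{j+1} : swap positions j and j+1 (0-based) of the one-line notation *)
Definition swapw (w : seq nat) (j : nat) : seq nat :=
  [seq nth 0%N w (if t == j then j.+1 else if t == j.+1 then j else t)
  | t <- iota 0 (size w)].

(* a reduced word [:: i1; ...; il] with w = s_{i1} ... s_{il} :
   if w has a descent at i, w = (w s_i) s_i with l(w s_i) = l(w) - 1 *)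
Fixpoint rword (fuel : nat) (w : seq nat) : seq nat :=
  if fuel is f.+1 then
    let j := find (fun t => nth 0%N w t.+1 < nth 0%N w t)%N (iota 0 (size w).-1) in
    if (j < (size w).-1)%N then rcons (rword f (swapw w j)) j.+1 else [::]
  else [::].

Definition redword (w : seq nat) : seq nat := rword (size w ^ 2) w.

Definition perm_len (w : seq nat) : nat :=
  (\sum_(i < size w) \sum_(j < size w)
     ((i < j) && (nth 0 w j < nth 0 w i)))%N.

(* nu = [:: nu_1; ...; nu_k], nu_i = nth 0 nu (i-1) *)
Definition in_box (n k : nat) (nu : seq nat) : bool :=
  [&& size nu == k, all (fun a => a <= n - k)%N nu & sorted geq nu].

Fixpoint allseqs (k m : nat) : seq (seq nat) :=
  if k is k'.+1 then [seq a :: s | a <- iota 0 m.+1, s <- allseqs k' m]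
  else [:: [::]].

Definition boxparts (n k : nat) : seq (seq nat) :=
  [seq s <- allseqs k (n - k) | sorted geq s].

(* w_nu : w_nu(k+1-i) = nu_i + k+1-i for 1 <= i <= k, increasing on {k+1..n} *)
Definition wnu (n k : nat) (nu : seq nat) : seq nat :=
  let top := [seq (nth 0 nu (k - a).-1 + a.+1)%N | a <- iota 0 k] in
  top ++ [seq v <- iota 1 n | v \notin top].

(* boxes (row, column) of the skew shape mu/lam, rows 1..k (English convention) *)
Definition skew_cells (k : nat) (mu lam : seq nat) : seq (nat * nat) :=
  [seq (r, c) | r <- iota 1 k,
     c <- iota (nth 0 lam r.-1).+1 (nth 0 mu r.-1 - nth 0 lam r.-1)].

Definition adjacent (a b : nat * nat) : bool :=
  ((a.1 == b.1) && ((a.2 == b.2.+1) || (b.2 == a.2.+1))) ||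
  ((a.2 == b.2) && ((a.1 == b.1.+1) || (b.1 == a.1.+1))).

Definition connected_cells (C : seq (nat * nat)) : Prop :=
  forall S : nat * nat -> Prop,
    (exists c, c \in C /\ S c) ->
    (forall c d, c \in C -> d \in C -> adjacent c d -> S c -> S d) ->
    forall c, c \in C -> S c.

(* mu/lam is a ribbon (nonempty connected skew shape, no 2x2 square)
   whose head (top-right box) lies in row i *)
Definition ribbon_head_row (k : nat) (mu lam : seq nat) (i : nat) : Prop :=
  let C := skew_cells k mu lam in
  [/\ (forall r, nth 0 lam r <= nth 0 mu r)%N,
      C != [::],
      connected_cells C,
      ~ (exists r c, [/\ (r, c) \in C, (r.+1, c) \in C,
                         (r, c.+1) \in C & (r.+1, c.+1) \in C]) &
      (* the head is in the top row of the ribbon *)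
      (exists c, (i, c) \in C) /\ (forall r c, (r, c) \in C -> i <= r)%N].

Definition ribbon_ht (k : nat) (mu lam : seq nat) : nat :=
  size (undup (map fst (skew_cells k mu lam))).
Definition ribbon_wd (k : nat) (mu lam : seq nat) : nat :=
  size (undup (map snd (skew_cells k mu lam))).

Section Hecke.
Variables (H : algType rat) (p q : H).

(* [m] = (p^m - q^m)/(p - q) = sum_{j<m} p^j q^{m-1-j} *)
Definition qint (m : nat) : H := \sum_(j < m) p ^+ j * q ^+ (m.-1 - j).
Definition qfact (m : nat) : H := \prod_(j < m) qint j.+1.

Variables (T : nat -> H).
Definition Tbar (i : nat) : H := T i + (p - q).
Definition Tbw (w : seq nat) : H := \prod_(i <- redword w) Tbar i.

Variables (cinv : H) (n k : nat).
(* cinv is (to be assumed) the inverse of [k]![n-k]! *)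
Definition dd : nat := ('C(k, 2) + 'C(n - k, 2))%N.
Definition Sigma : H :=
  cinv * \sum_(a <- permutations (iota 1 k))
           \sum_(b <- permutations (iota k.+1 (n - k)))
              q ^+ (dd - perm_len (a ++ b)) * Tbw (a ++ b).

Definition Tnu (nu : seq nat) : H := Tbw (wnu n k nu) * Sigma.

Variables (hb : H) (x : nat -> H).

(* left A[x]-combinations of the Tbar_nu: formal lists of (coefficient, nu) *)
Definition Dop (i : nat) (L : seq (H * seq nat)) : seq (H * seq nat) :=
  flatten [seq
    (gm.1 * x (nth 0 gm.2 i.-1 + k.+1 - i)%N, gm.2) ::
    [seq (gm.1 * ((hb - (p - q) * x (nth 0 gm.2 i.-1 + k.+1 - i)%N)
              * p ^+ (ribbon_ht k gm.2 lam).-1 * q ^+ (ribbon_wd k gm.2 lam).-1), lam)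
    | lam <- boxparts n k & isb (ribbon_head_row k gm.2 lam i)]
  | gm <- L].

Definition evalc (L : seq (H * seq nat)) : H := \sum_(gm <- L) gm.1 * Tnu gm.2.

End Hecke.

Fixpoint incr_choose (l : seq nat) (r : nat) : seq (seq nat) :=
  match r, l with
  | 0%N, _ => [:: [::]]
  | _.+1, [::] => [::]
  | r'.+1, a :: l' => [seq a :: s | s <- incr_choose l' r'] ++ incr_choose l' r
  end.

Definition elem_sym (R : pzRingType) (x : nat -> R) (k r : nat) : R :=
  \sum_(s <- incr_choose (iota 1 k) r) \prod_(i <- s) x i.

(* Main.v *)
Require Import Defs.
From mathcomp Require Import all_boot all_order all_algebra zify.
From Stdlib Require Import ClassicalEpsilon.
Set Implicit Arguments. Unset Strict Implicit. Unset Printing Implicit Defensive.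
Import GRing.Theory.

(** Write t_i = T_i + p - q and c_j = hbar - (p - q) x_j, so that
    t_i x_i = x_(i+1) t_i + c_(i+1) and t_i c_i = c_(i+1) T_i.
    The element w_mu has the reduced word C_k ... C_2 C_1, where row i contributes the
    descending run C_i = s_(a+mu_i-1) ... s_a with a = k+1-i.  Moving x_a leftwards
    through this word leaves it as x_(a+mu_i) or breaks the run C_i at some m < mu_i.
    In the second case the letters left of the break are shifted to indices above k and
    are absorbed by the symmetrizer, each giving a factor q; the remaining product, in
    which row i has length m, is straightened by exchanging it with the longer rows
    below it, each exchange releasing a letter of index below a which is absorbed with a
    factor p.  The result is the ribbon with head in row i and last row of length m, and
    every ribbon arises once.  Only letters of index above k or below a have to be
    absorbed, and these commute with x_b for a < b <= k.  Hence
    D_(i_1) ... D_(i_r) of the basis element of mu is that element with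
    x_(k+1-i_r) ... x_(k+1-i_1) inserted before the symmetrizer, term by term, and
    e_r(x_1, ..., x_k) commutes with the symmetrizer. *)

Local Open Scope nat_scope.

(** * Descents and reduced words *)

Definition adjswap (j t : nat) : nat :=
  if t == j then j.+1 else if t == j.+1 then j else t.

Ltac adjswap_lia := rewrite /adjswap; do ?[case: eqP => //=]; lia.

Lemma adjswapK j : involutive (adjswap j).
Proof. move=> t; adjswap_lia. Qed.

Lemma adjswap_inj j : injective (adjswap j).
Proof. exact/can_inj/adjswapK. Qed.

Lemma adjswapL j : adjswap j j = j.+1.
Proof. adjswap_lia. Qed.

Lemma adjswapR j : adjswap j j.+1 = j.
Proof. adjswap_lia. Qed.

Lemma adjswap_id j t : t != j -> t != j.+1 -> adjswap j t = t.
Proof. adjswap_lia. Qed.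

Lemma adjswap_lt j m t : j.+1 < m -> (adjswap j t < m) = (t < m).
Proof. adjswap_lia. Qed.

Lemma size_swapw w j : size (swapw w j) = size w.
Proof. by rewrite size_map size_iota. Qed.

Lemma nth_swapw w j t : j.+1 < size w -> nth 0 (swapw w j) t = nth 0 w (adjswap j t).
Proof.
move=> lt_j; case: (ltnP t (size w)) => lt_t.
  by rewrite (nth_map 0) ?size_iota // nth_iota.
by rewrite !nth_default ?size_swapw // leqNgt adjswap_lt // -leqNgt.
Qed.

Lemma swapw_far w i j : i.+1 < j -> j.+1 < size w ->
  swapw (swapw w i) j = swapw (swapw w j) i.
Proof.
move=> lt_ij lt_j; apply: (@eq_from_nth _ 0) => [|s _]; first by rewrite !size_swapw.
rewrite !nth_swapw ?size_swapw; try lia.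
by congr nth; adjswap_lia.
Qed.

Lemma swapw_braid w i : i.+2 < size w ->
  swapw (swapw (swapw w i) i.+1) i = swapw (swapw (swapw w i.+1) i) i.+1.
Proof.
move=> lt_i; apply: (@eq_from_nth _ 0) => [|s _]; first by rewrite !size_swapw.
rewrite !nth_swapw ?size_swapw; try lia.
by congr nth; adjswap_lia.
Qed.

Lemma map_adjswap_swapw w l j : j.+1 < size w ->
  map (adjswap l) (swapw w j) = swapw (map (adjswap l) w) j.
Proof.
move=> lt_j; apply: (@eq_from_nth _ 0) => [|s]; rewrite ?(size_map, size_swapw) // => lt_s.
rewrite nth_swapw ?size_map // !(nth_map 0 0 (adjswap l)) ?size_swapw ?adjswap_lt //.
by rewrite nth_swapw.
Qed.

Lemma perm_swapw w j : j.+1 < size w -> perm_eq (swapw w j) w.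
Proof.
move=> lt_j.
have -> : swapw w j = map (nth 0 w) (map (adjswap j) (iota 0 (size w))).
  by rewrite -map_comp.
rewrite -[X in perm_eq _ X](mkseq_nth 0); apply/perm_map/uniq_perm.
- by rewrite map_inj_uniq ?iota_uniq //; apply: adjswap_inj.
- exact: iota_uniq.
move=> t; rewrite -{1}(adjswapK j t) mem_map; last exact: adjswap_inj.
by rewrite !mem_iota /= !add0n adjswap_lt.
Qed.

Lemma index_swapw w v j : uniq w -> j.+1 < size w -> v \in w ->
  index v (swapw w j) = adjswap j (index v w).
Proof.
move=> uw lt_j v_w; rewrite -{1}(nth_index 0 v_w) -{1}(adjswapK j (index v w)).
rewrite -nth_swapw // index_uniq ?(perm_uniq (perm_swapw lt_j)) //.
by rewrite size_swapw adjswap_lt // index_mem.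
Qed.

Definition descent (w : seq nat) (j : nat) : bool :=
  (j.+1 < size w) && (nth 0 w j.+1 < nth 0 w j).

Definition first_descent (w : seq nat) : nat :=
  find (fun t => nth 0 w t.+1 < nth 0 w t) (iota 0 (size w).-1).

Lemma first_descentE w : (first_descent w < (size w).-1) = descent w (first_descent w).
Proof.
apply/idP/andP => [lt_d|[]]; last by lia.
have has_d : has (fun t => nth 0 w t.+1 < nth 0 w t) (iota 0 (size w).-1).
  by rewrite has_find size_iota.
have := nth_find 0 has_d; rewrite -/(first_descent w) nth_iota ?add0n //.
by split => //; lia.
Qed.

Lemma first_descent_le w j : descent w j -> first_descent w <= j.
Proof.
case/andP=> lt_j desc_j; rewrite leqNgt; apply/negP => /(before_find 0).
by rewrite nth_iota ?add0n ?desc_j //; lia.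
Qed.

Lemma descent_first w j : descent w j -> descent w (first_descent w).
Proof.
move=> desc_j; rewrite -first_descentE.
by have := first_descent_le desc_j; case/andP: desc_j; lia.
Qed.

Lemma perm_len_swapw w j : descent w j -> perm_len w = (perm_len (swapw w j)).+1.
Proof.
case/andP=> lt_j desc_j; rewrite /perm_len size_swapw; move: lt_j (nth_swapw (w := w)).
move: (size w) => N lt_j nth_w.
pose so (i : 'I_N) : 'I_N := Ordinal (etrans (adjswap_lt i lt_j) (ltn_ord i)).
have soK : involutive so by move=> i; apply/val_inj/adjswapK.
have -> : \sum_(i < N) \sum_(s < N)
    ((i < s) && (nth 0 (swapw w j) s < nth 0 (swapw w j) i)) =
  \sum_(i < N) \sum_(s < N) ((so i < so s) && (nth 0 w s < nth 0 w i)).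
  rewrite (reindex_inj (can_inj soK)); apply: eq_bigr => a _.
  rewrite (reindex_inj (can_inj soK)); apply: eq_bigr => b _.
  by rewrite !nth_w //= !adjswapK.
rewrite !pair_big /=.
pose ij := (Ordinal (ltnW lt_j), Ordinal lt_j).
rewrite (bigD1 ij) //= [in RHS](bigD1 ij) //= desc_j ltnSn adjswapL adjswapR.
rewrite ltnNge leqnSn add0n add1n; congr _.+1.
apply: eq_bigr => -[a b] /=; rewrite xpair_eqE -!val_eqE /= => ne_ij.
case: (ltnP (nth 0 w b) (nth 0 w a)) => lt_ba; last by rewrite !andbF.
rewrite !andbT; congr nat_of_bool.
have ne_ji : ~~ ((val a == j.+1) && (val b == j)).
  by apply/negP => /andP[/eqP a_j /eqP b_j]; rewrite a_j b_j in lt_ba; lia.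
by move: ne_ij ne_ji => /=; adjswap_lia.
Qed.

Lemma descent_ind (P : seq nat -> Prop) :
  (forall w, (forall j, ~~ descent w j) -> P w) ->
  (forall w (j := first_descent w), descent w j -> P (swapw w j) -> P w) ->
  forall w, P w.
Proof.
move=> P_sorted P_descent w.
have [N] := ubnP (perm_len w); elim: N w => // N IH w lt_N.
have [desc_w|ndesc_w] := boolP (descent w (first_descent w)).
  by apply: P_descent => //; apply: IH; have := perm_len_swapw desc_w; lia.
by apply: P_sorted => j; apply: contra ndesc_w; apply: descent_first.
Qed.

Lemma perm_len_le_bin w : perm_len w <= 'C(size w, 2).
Proof.
rewrite -bin2_sum big_mkord /perm_len exchange_big leq_sum //= => j _.
apply: (@leq_trans (\sum_(i < size w | i < j) 1)).
  by rewrite [leqRHS]big_mkcond leq_sum //= => i _; case: (i < j) => //=; apply: leq_b1.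
by rewrite -(big_ord_widen _ (fun=> 1)) ?sum1_card ?card_ord // ltnW.
Qed.

Lemma rwordS f w : rword f.+1 w =
  if descent w (first_descent w)
  then rcons (rword f (swapw w (first_descent w))) (first_descent w).+1 else [::].
Proof. by rewrite -first_descentE. Qed.

Lemma rword_fuel f g w : perm_len w <= f -> perm_len w <= g -> rword f w = rword g w.
Proof.
elim: f g w => [|f IH] [|g] w // le_f le_g; rewrite ?rwordS //; case: ifP => //.
- by move/perm_len_swapw; lia.
- by move/perm_len_swapw; lia.
by move/perm_len_swapw=> len_w; congr rcons; apply: IH; lia.
Qed.

Lemma redwordE w : redword w =
  if descent w (first_descent w)
  then rcons (redword (swapw w (first_descent w))) (first_descent w).+1 else [::].
Proof.
have le_len v : perm_len v <= size v ^ 2.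
  by apply: leq_trans (perm_len_le_bin v) _; rewrite bin2; nia.
rewrite [in RHS]/redword size_swapw -rwordS.
by apply: rword_fuel => //; apply: leqW.
Qed.

Lemma redword_nil w : (forall j, ~~ descent w j) -> redword w = [::].
Proof. by move=> ndesc_w; rewrite redwordE (negbTE (ndesc_w _)). Qed.

Lemma mem_redword w l : l \in redword w -> 0 < l < size w.
Proof.
elim/descent_ind: w => [w /redword_nil -> //|w j desc_j IH].
rewrite redwordE desc_j mem_rcons in_cons => /orP[/eqP->|/IH]; last by rewrite size_swapw.
by case/andP: desc_j; lia.
Qed.

Definition separated (k : nat) (w : seq nat) : Prop :=
  forall s t, s < k -> k <= t < size w -> nth 0 w s < nth 0 w t.

Lemma redword_separated w k l : separated k w -> l \in redword w -> l != k.
Proof.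
elim/descent_ind: w => [w /redword_nil -> //|w j desc_j IH sep_w].
case/andP: (desc_j) => lt_j lt_nth.
have ne_k : j.+1 != k by apply/eqP => j_k; have := sep_w j j.+1; lia.
rewrite redwordE desc_j mem_rcons in_cons => /orP[/eqP-> //|]; apply: IH => s t lt_s.
by rewrite size_swapw !nth_swapw // => lt_t; apply: sep_w; adjswap_lia.
Qed.

Lemma perm_len_cat a b : separated (size a) (a ++ b) ->
  perm_len (a ++ b) = perm_len a + perm_len b.
Proof.
move=> sep_ab; rewrite /perm_len size_cat big_split_ord /=.
have nthL (i : 'I_(size a)) : nth 0 (a ++ b) i = nth 0 a i by rewrite nth_cat ltn_ord.
have nthR i : nth 0 (a ++ b) (size a + i) = nth 0 b i.
  by rewrite nth_cat ltnNge leq_addr addKn.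
congr (_ + _); apply: eq_bigr => i _; rewrite big_split_ord /=.
  rewrite [X in _ + X]big1 ?addn0 => [|j _]; first by apply: eq_bigr => j _; rewrite !nthL.
  have := sep_ab i (size a + j); rewrite size_cat leq_addr ltn_add2l !ltn_ord.
  by move=> /(_ isT isT)/ltnW/leq_gtF->; rewrite andbF.
rewrite [X in X + _]big1 ?add0n => [|j _].
  by apply: eq_bigr => j _; rewrite !nthR ltn_add2l.
by rewrite ltnNge (leq_trans (ltnW (ltn_ord j)) (leq_addr _ _)).
Qed.

(** * Left multiplication by an adjacent transposition *)

Lemma descent_map_adjswap w l j : uniq w -> index l w < index l.+1 w ->
  descent w j -> descent (map (adjswap l) w) j.
Proof.
move=> uw lt_idx /andP[lt_j desc_j]; rewrite /descent size_map lt_j /=.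
rewrite !(nth_map 0) ?(ltnW lt_j) //.
suff : ~ (nth 0 w j = l.+1 /\ nth 0 w j.+1 = l) by move: desc_j; adjswap_lia.
case=> nth_j nth_jS; move: lt_idx.
by rewrite -{1}nth_jS -nth_j !index_uniq ?(ltnW lt_j) // ltnNge leqnSn.
Qed.

Section LeftMultiplication.
Variables (n l : nat).
Hypothesis l_lt : 0 < l < n.
Implicit Types w : seq nat.

Lemma adjswap_iota_descent : descent (map (adjswap l) (iota 1 n)) l.-1.
Proof.
rewrite /descent size_map size_iota; apply/andP; split; first by lia.
by rewrite !(nth_map 0) ?nth_iota ?size_iota; adjswap_lia.
Qed.

Lemma swapw_adjswap_iota : swapw (map (adjswap l) (iota 1 n)) l.-1 = iota 1 n.
Proof.
apply: (@eq_from_nth _ 0); rewrite size_swapw size_map ?size_iota // => s lt_s.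
have lt_l : l.-1.+1 < n by lia.
rewrite nth_swapw ?size_map ?size_iota // (nth_map 0) ?size_iota ?adjswap_lt //.
by rewrite !nth_iota ?adjswap_lt //; adjswap_lia.
Qed.

Lemma no_descent_iota w :
  perm_eq w (iota 1 n) -> (forall j, ~~ descent w j) -> w = iota 1 n.
Proof.
move=> w_perm ndesc_w; apply: (sorted_eq leq_trans anti_leq) => //; last exact: iota_sorted.
by apply/(sortedP 0) => j lt_j; have := ndesc_w j; rewrite /descent lt_j -leqNgt.
Qed.

Lemma index_swapw_lt w j : perm_eq w (iota 1 n) -> descent w j ->
  index l w < index l.+1 w -> index l (swapw w j) < index l.+1 (swapw w j).
Proof.
move=> w_perm /andP[lt_j desc_j] lt_idx.
have uw : uniq w by rewrite (perm_uniq w_perm) iota_uniq.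
have l_w : l \in w by rewrite (perm_mem w_perm) mem_iota; lia.
have lS_w : l.+1 \in w by rewrite (perm_mem w_perm) mem_iota; lia.
rewrite !index_swapw //.
suff : ~ (index l w = j /\ index l.+1 w = j.+1) by move: lt_idx; adjswap_lia.
case=> idx_l idx_lS; move: desc_j.
by rewrite -{1}idx_lS -idx_l !nth_index //; lia.
Qed.

Lemma index_map_adjswap_lt w : perm_eq w (iota 1 n) ->
  (index l (map (adjswap l) w) < index l.+1 (map (adjswap l) w)) =
  ~~ (index l w < index l.+1 w).
Proof.
move=> w_perm; have inj := @adjswap_inj l.
have -> : index l (map (adjswap l) w) = index l.+1 w by rewrite -{1}(adjswapR l) index_map.
have -> : index l.+1 (map (adjswap l) w) = index l w by rewrite -{1}(adjswapL l) index_map.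
rewrite -leqNgt ltn_neqAle; suff -> : index l.+1 w != index l w by [].
have l_w : l \in w by rewrite (perm_mem w_perm) mem_iota; lia.
have lS_w : l.+1 \in w by rewrite (perm_mem w_perm) mem_iota; lia.
by apply/eqP => eq_idx; have := nth_index 0 lS_w; rewrite eq_idx nth_index //; lia.
Qed.

Lemma perm_len_map_adjswap w : perm_eq w (iota 1 n) -> index l w < index l.+1 w ->
  perm_len (map (adjswap l) w) = (perm_len w).+1.
Proof.
elim/descent_ind: w => [w ndesc_w|w j desc_j IH] w_perm lt_idx.
  rewrite (no_descent_iota w_perm ndesc_w).
  by rewrite (perm_len_swapw adjswap_iota_descent) swapw_adjswap_iota.
have [lt_j _] := andP desc_j.
have uw : uniq w by rewrite (perm_uniq w_perm) iota_uniq.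
rewrite (perm_len_swapw (descent_map_adjswap uw lt_idx desc_j)) -map_adjswap_swapw //.
rewrite IH ?(perm_len_swapw desc_j) //; last exact: index_swapw_lt.
exact: perm_trans (perm_swapw lt_j) w_perm.
Qed.

End LeftMultiplication.

(** * Partitions *)

Lemma sorted_geq_nth s a b : sorted geq s -> a <= b -> nth 0 s b <= nth 0 s a.
Proof.
move=> s_sorted le_ab; have [lt_b|le_b] := ltnP b (size s); last by rewrite nth_default.
by apply: (sorted_leq_nth (rev_trans leq_trans) leqnn 0 s_sorted) => //; rewrite inE; lia.
Qed.

Lemma sorted_geqP s : reflect (forall r, nth 0 s r.+1 <= nth 0 s r) (sorted geq s).
Proof.
apply: (iffP idP) => [s_sorted r|mono_s]; first exact: sorted_geq_nth.
by apply/(sortedP 0) => r _; apply: mono_s.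
Qed.

Lemma lt_nth_size m s r : m < nth 0 s r -> r < size s.
Proof.
by move=> lt_m; rewrite ltnNge; apply: contraL lt_m => le_r; rewrite nth_default.
Qed.

Definition nrows_gt (m : nat) (s : seq nat) : nat := count (fun c => m < c) s.

Arguments nrows_gt : simpl never.

Lemma nrows_gt_cons m c s : nrows_gt m (c :: s) = (m < c) + nrows_gt m s.
Proof. by []. Qed.

Lemma lt_nrows_gt s m r : sorted geq s -> (r < nrows_gt m s) = (m < nth 0 s r).
Proof.
elim: s r => [|c s IH] r s_sorted; first by rewrite nth_nil.
rewrite nrows_gt_cons; have [lt_m|le_c] := ltnP m c.
  by case: r => [|r]; rewrite ?lt_m //= add1n ltnS IH // (path_sorted s_sorted).
have /= := sorted_geq_nth s_sorted (leq0n r) => le_r.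
rewrite add0n; suff -> : nrows_gt m s = 0 by lia.
apply/eqP; rewrite -leqn0 leqNgt (IH 0) ?(path_sorted s_sorted) // -leqNgt.
by apply: leq_trans le_c; apply: (sorted_geq_nth s_sorted (leq0n 1)).
Qed.

Lemma in_boxP n k mu :
  reflect (size mu = k /\ forall r, nth 0 mu r.+1 <= nth 0 mu r <= n - k) (in_box n k mu).
Proof.
apply: (iffP and3P) => [[/eqP sz /(all_nthP 0) bnd /sorted_geqP mono]|[sz mono_bnd]].
  split=> // r; rewrite mono /=; have [/bnd //|le_r] := ltnP r (size mu).
  by rewrite nth_default.
have /all_and2[mono bnd] r := andP (mono_bnd r).
by split; [apply/eqP|apply/(all_nthP 0) => r _|apply/sorted_geqP].
Qed.

Lemma mem_allseqs k m s : (s \in allseqs k m) = (size s == k) && all (fun a => a <= m) s.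
Proof.
elim: k s => [|k IH] s; first by rewrite inE; case: s.
rewrite -[allseqs k.+1 m]/[seq a :: s | a <- iota 0 m.+1, s <- allseqs k m].
apply/allpairsPdep/idP => [[a [u [a_iota u_all ->]]]|].
  by move: u_all a_iota; rewrite IH mem_iota /= eqSS; lia.
case: s => // a s; rewrite [size _]/= eqSS [all _ _]/= => /and3P[sz le_a le_s].
by exists a, s; rewrite mem_iota IH sz le_s.
Qed.

Lemma mem_boxparts n k s : (s \in boxparts n k) = in_box n k s.
Proof. by rewrite mem_filter mem_allseqs /in_box andbC andbA. Qed.

Lemma boxparts_uniq n k : uniq (boxparts n k).
Proof.
apply: filter_uniq; move: (n - k) => m; elim: k => // k IH.
rewrite -[allseqs k.+1 m]/[seq a :: s | a <- iota 0 m.+1, s <- allseqs k m].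
by apply: allpairs_uniq; rewrite ?iota_uniq // => -[a s] [b r] _ _ /= [-> ->].
Qed.

(** * Ribbons *)

Fixpoint insert_row (m : nat) (s : seq nat) : seq nat :=
  if s is c :: s' then
    if m < c then c.-1 :: insert_row m s' else m :: s
  else [:: m].

Lemma size_insert_row m s : size (insert_row m s) = (size s).+1.
Proof. by elim: s => //= c s IH; case: ifP => //= _; rewrite IH. Qed.

Lemma nth_insert_row m s r : sorted geq s ->
  nth 0 (insert_row m s) r =
  (if r is r'.+1 then minn (nth 0 s r') else id) (maxn m (nth 0 s r).-1).
Proof.
elim: s r => [|c s IH] [|r] s_sorted /=; rewrite ?nth_nil ?min0n ?maxn0 //.
  by case: ltnP => /=; lia.
have /= le_r := sorted_geq_nth s_sorted (leq0n r).
have /= le_rS := sorted_geq_nth s_sorted (leq0n r.+1).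
case: ltnP => le_c /=; last by lia.
by rewrite IH ?(path_sorted s_sorted) //; case: r le_r le_rS => //= _; lia.
Qed.

(* Rows are counted from 0.  The boxes of [mu] in the columns right of [m] and in the rows
   from [i] on whose lower right neighbour lies outside [mu] form the ribbon removed. *)
Definition remove_ribbon (i m : nat) (mu : seq nat) : seq nat :=
  take i mu ++ insert_row m (drop i.+1 mu).

Lemma size_remove_ribbon i m mu : i < size mu -> size (remove_ribbon i m mu) = size mu.
Proof. by move=> lt_i; rewrite size_cat size_take size_insert_row size_drop lt_i; lia. Qed.

Lemma connected_cells_of_descent (C : seq (nat * nat)) o (f : nat * nat -> nat) :
  (forall c, c \in C -> c != o -> exists d, [/\ d \in C, adjacent c d & f d < f c]) ->
  connected_cells C.
Proof.
move=> to_o S [c0 [c0_C S_c0]] S_adj.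
have adjC c d : adjacent c d = adjacent d c by rewrite /adjacent; lia.
have S_o c : c \in C -> S c <-> S o.
  have [N] := ubnP (f c); elim: N c => // N IH c lt_N c_C.
  have [-> //|/(to_o c c_C)[d [d_C adj_cd lt_d]]] := eqVneq c o.
  rewrite -(IH d) //; last by lia.
  by split; apply: S_adj; rewrite // adjC.
by move=> c c_C; apply/(S_o c c_C)/(S_o c0 c0_C).
Qed.

Lemma mem_skew_cells k mu lam r c : ((r, c) \in skew_cells k mu lam) =
  (0 < r <= k) && (nth 0 lam r.-1 < c <= nth 0 mu r.-1).
Proof.
(* [skew_cells] takes its default entry to be the zero of nat as a ring. *)
rewrite [skew_cells _ _ _]/[seq (r, c) | r <- iota 1 k,
  c <- iota (nth 0 lam r.-1).+1 (nth 0 mu r.-1 - nth 0 lam r.-1)].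
apply/allpairsPdep/idP => [[r' [c' [r_iota c_iota [-> ->]]]]|rc].
  by move: r_iota c_iota; rewrite !mem_iota; lia.
by exists r, c; rewrite !mem_iota; split => //; lia.
Qed.

Section RemoveRibbon.
Variables (mu : seq nat) (i m : nat).
Hypotheses (mu_sorted : sorted geq mu) (lt_m : m < nth 0 mu i).

Let lt_i : i < size mu := lt_nth_size lt_m.

Lemma nth_remove_ribbon r : nth 0 (remove_ribbon i m mu) r =
  if r < i then nth 0 mu r else minn (nth 0 mu r) (maxn m (nth 0 mu r.+1).-1).
Proof.
rewrite nth_cat size_take lt_i; case: ltnP => [lt_r|le_i]; first by rewrite nth_take.
rewrite nth_insert_row ?drop_sorted //.
have [->|ne_i] := eqVneq r i.
  by rewrite subnn nth_drop addn0; have := sorted_geq_nth mu_sorted (leqnSn i); lia.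
have -> : r - i = (r - i.+1).+1 by lia.
by rewrite !nth_drop; congr (minn (nth _ _ _) (maxn _ (nth _ _ _).-1)); lia.
Qed.

Lemma remove_ribbon_le r : nth 0 (remove_ribbon i m mu) r <= nth 0 mu r.
Proof. by rewrite nth_remove_ribbon; case: ifP => // _; apply: geq_minl. Qed.

Lemma remove_ribbon_sorted : sorted geq (remove_ribbon i m mu).
Proof.
apply/sorted_geqP => r; rewrite !nth_remove_ribbon.
have := sorted_geq_nth mu_sorted (leqnSn r).
have := sorted_geq_nth mu_sorted (leqnSn r.+1).
by case: (ltnP r i) => ?; case: (ltnP r.+1 i) => ?; lia.
Qed.

Variable k : nat.
Hypothesis size_mu : size mu <= k.
Let lam := remove_ribbon i m mu.

Lemma mem_skew_remove_ribbon r c : ((r, c) \in skew_cells k mu lam) =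
  [&& i < r, m < c & nth 0 mu r <= c <= nth 0 mu r.-1].
Proof.
rewrite mem_skew_cells nth_remove_ribbon; case: r => //= r.
have : r < k \/ nth 0 mu r = 0.
  by case: (ltnP r k) => [|le_k]; [left|right; apply: nth_default; lia].
have := sorted_geq_nth mu_sorted (leqnSn r).
by case: (ltnP r i); lia.
Qed.

Lemma skew_remove_ribbon_head : (i.+1, nth 0 mu i) \in skew_cells k mu lam.
Proof.
by rewrite mem_skew_remove_ribbon ltnSn lt_m leqnn (sorted_geq_nth mu_sorted (leqnSn i)).
Qed.

Lemma skew_remove_ribbon_connected : connected_cells (skew_cells k mu lam).
Proof.
pose dist (c : nat * nat) := c.1 + (nth 0 mu i - c.2).
apply: (@connected_cells_of_descent _ (i.+1, nth 0 mu i) dist) => -[r c].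
rewrite mem_skew_remove_ribbon xpair_eqE => /and3P[lt_r lt_c /andP[le_mu ge_mu]] ne_head.
have := sorted_geq_nth mu_sorted (leq_pred r.-1).
have := @sorted_geq_nth mu i r.-1 mu_sorted; rewrite /dist.
have [eq_c|ne_c] := eqVneq c (nth 0 mu r.-1) => le_i le_r.
  have lt_ir : i.+1 < r.
    rewrite ltn_neqAle lt_r andbT eq_sym; apply: contraNneq ne_head => eq_r.
    by rewrite eq_c eq_r !eqxx.
  exists (r.-1, c); rewrite mem_skew_remove_ribbon /adjacent /=; split; lia.
exists (r, c.+1); rewrite mem_skew_remove_ribbon /adjacent /=; split; lia.
Qed.

Lemma ribbon_remove_ribbon : ribbon_head_row k mu lam i.+1.
Proof.
have head := skew_remove_ribbon_head.
split; first exact: remove_ribbon_le.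
- by apply: contraTneq head => ->.
- exact: skew_remove_ribbon_connected.
- by case=> r [c []]; rewrite !mem_skew_remove_ribbon /=; lia.
by split=> [|r c]; [exists (nth 0 mu i)|rewrite mem_skew_remove_ribbon => /and3P[]].
Qed.

Lemma ribbon_ht_remove_ribbon : ribbon_ht k mu lam = (nrows_gt m (drop i.+1 mu)).+1.
Proof.
have lt_nrows r : (r < (nrows_gt m (drop i.+1 mu)).+1) = (m < nth 0 mu (i + r)).
  have -> : (nrows_gt m (drop i.+1 mu)).+1 = nrows_gt m (drop i mu).
    by rewrite (drop_nth 0 lt_i) nrows_gt_cons lt_m.
  by rewrite lt_nrows_gt ?drop_sorted // nth_drop.
rewrite -[RHS](size_iota i.+1).
apply/perm_size/uniq_perm; rewrite ?undup_uniq ?iota_uniq //.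
move=> r; rewrite mem_undup mem_iota; apply/mapP/idP => [[[s c] sc /= ->]|r_iota].
  move: sc; rewrite mem_skew_remove_ribbon => /and3P[lt_s lt_c c_bnd].
  by have := lt_nrows (s - i.+1); rewrite (_ : i + _ = s.-1); lia.
exists (r, nth 0 mu r.-1) => //; rewrite mem_skew_remove_ribbon.
have := lt_nrows (r - i.+1); rewrite (_ : i + _ = r.-1); last by lia.
by have := sorted_geq_nth mu_sorted (leq_pred r); lia.
Qed.

Lemma ribbon_wd_remove_ribbon : ribbon_wd k mu lam = nth 0 mu i - m.
Proof.
rewrite -[RHS](size_iota m.+1).
apply/perm_size/uniq_perm; rewrite ?undup_uniq ?iota_uniq //.
move=> c; rewrite mem_undup mem_iota; apply/mapP/idP => [[[r d] rd /= ->]|c_iota].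
  move: rd; rewrite mem_skew_remove_ribbon => /and3P[lt_r lt_c c_bnd].
  by have := @sorted_geq_nth mu i r.-1 mu_sorted; lia.
have lt_nrows r : (r < nrows_gt c.-1 mu) = (c <= nth 0 mu r) by rewrite lt_nrows_gt //; lia.
exists (nrows_gt c.-1 mu, c) => //; rewrite mem_skew_remove_ribbon.
have := lt_nrows i; have := lt_nrows (nrows_gt c.-1 mu).
by have := lt_nrows (nrows_gt c.-1 mu).-1; lia.
Qed.

End RemoveRibbon.

Lemma remove_ribbon_inj mu i m m' : sorted geq mu -> m < nth 0 mu i -> m' < nth 0 mu i ->
  remove_ribbon i m mu = remove_ribbon i m' mu -> m = m'.
Proof.
move=> mu_sorted lt_m lt_m' eq_lam.
have := ribbon_wd_remove_ribbon mu_sorted lt_m (leqnn _).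
rewrite eq_lam (ribbon_wd_remove_ribbon mu_sorted lt_m' (leqnn _)); lia.
Qed.

Section RibbonHead.
Variables (k : nat) (mu lam : seq nat) (i : nat).
Hypothesis rib : ribbon_head_row k mu lam i.+1.

Lemma ribbon_head_lt : nth 0 lam i < nth 0 mu i.
Proof.
by case: rib => _ _ _ _ [[c head] _]; move: head; rewrite mem_skew_cells /=; lia.
Qed.

Lemma ribbon_no_square r : sorted geq mu -> sorted geq lam -> r.+1 < k ->
  nth 0 mu r.+1 <= (nth 0 lam r).+1.
Proof.
case: rib => _ _ _ no_square _ mu_sorted lam_sorted lt_k.
rewrite leqNgt; apply/negP => square.
apply: no_square; exists r.+1, (nth 0 lam r).+1.
have := sorted_geq_nth mu_sorted (leqnSn r); have := sorted_geq_nth lam_sorted (leqnSn r).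
by rewrite !mem_skew_cells /=; split; lia.
Qed.

Hypothesis size_mu : size mu = k.

Lemma ribbon_above_head r : r < i -> nth 0 lam r = nth 0 mu r.
Proof.
case: rib => le_lam _ _ _ [_ top] lt_r; apply/eqP; rewrite eqn_leq le_lam leqNgt.
apply/negP => lt_lam; have := top r.+1 (nth 0 mu r); rewrite mem_skew_cells /=.
have : r < k by rewrite -size_mu; apply: lt_nth_size lt_lam.
lia.
Qed.

(* Otherwise the cells in the rows up to [r] are not adjacent to those below. *)
Lemma ribbon_rows_overlap r r' : i <= r < r' -> nth 0 lam r' < nth 0 mu r' ->
  nth 0 lam r < nth 0 mu r.+1.
Proof.
case: rib => _ _ conn _ [[c0 head] _] lt_r lt_r'.
rewrite ltnNge; apply/negP => no_overlap.
have lt_k : r' < k by rewrite -size_mu; apply: lt_nth_size lt_r'.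
suff : r'.+1 <= r.+1 by lia.
apply: (conn (fun c => c.1 <= r.+1) _ _ (r'.+1, nth 0 mu r')).
- by exists (i.+1, c0); split => //=; lia.
- move=> [r1 c1] [r2 c2] /=; rewrite !mem_skew_cells /adjacent /= => rc1 rc2 adj le_r1.
  rewrite leqNgt; apply/negP => gt_r2.
  have [e1 e2] : r1 = r.+1 /\ r2 = r.+2 by lia.
  by move: rc1 rc2 adj; rewrite e1 e2 /=; lia.
by rewrite mem_skew_cells /= lt_r' leqnn !andbT.
Qed.

Hypotheses (mu_sorted : sorted geq mu) (lam_sorted : sorted geq lam).
Hypothesis size_lam : size lam = k.

Lemma ribbon_head_row_remove_ribbon : exists2 m, m < nth 0 mu i & lam = remove_ribbon i m mu.
Proof.
pose nonempty r := nth 0 lam r < nth 0 mu r.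
have nonempty_le r : nonempty r -> r <= k by move/lt_nth_size/ltnW; rewrite size_mu.
case: (ex_maxnP (ex_intro nonempty i ribbon_head_lt) nonempty_le) => h lt_lam max_h.
have le_ih : i <= h by apply/max_h/ribbon_head_lt.
have lt_h : nth 0 lam h < nth 0 mu i.
  exact: leq_trans lt_lam (sorted_geq_nth mu_sorted le_ih).
exists (nth 0 lam h) => //.
apply: (@eq_from_nth _ 0) => [|r lt_r].
  by rewrite size_remove_ribbon ?(lt_nth_size lt_h) // size_lam size_mu.
rewrite nth_remove_ribbon //; case: ltnP => [/ribbon_above_head //|le_r].
have below_h s : h < s -> nth 0 lam s = nth 0 mu s.
  have [le_lam _ _ _ _] := rib; move=> lt_s; apply/eqP; rewrite eqn_leq le_lam.
  by rewrite leqNgt; apply: contraL lt_s => /max_h; rewrite -leqNgt.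
have lam_le s t : s <= t -> nth 0 lam t <= nth 0 lam s by apply: sorted_geq_nth.
have [lt_rh|lt_hr|eq_rh] := ltngtP r h.
- have := ribbon_rows_overlap _ lt_lam; have := @ribbon_no_square r mu_sorted lam_sorted.
  have := lt_nth_size lt_lam; rewrite size_mu => lt_hk no_square overlap.
  have := overlap r; have := lam_le r h.
  by have := sorted_geq_nth mu_sorted (leqnSn r); lia.
- have := below_h r; have := below_h r.+1.
  by have := lam_le h r; have := lam_le r r.+1; lia.
have := below_h h.+1; have := lam_le h h.+1; rewrite eq_rh /nonempty in lt_lam *; lia.
Qed.

End RibbonHead.

Lemma in_box_remove_ribbon n k mu i m : in_box n k mu -> m < nth 0 mu i ->
  in_box n k (remove_ribbon i m mu).
Proof.
move=> mu_box lt_m; have /and3P[_ _ mu_sorted] := mu_box.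
have /in_boxP[size_mu mu_bnd] := mu_box.
have lt_i := lt_nth_size lt_m.
apply/in_boxP; rewrite size_remove_ribbon //; split=> // r.
have /sorted_geqP -> := remove_ribbon_sorted mu_sorted lt_m.
by apply: leq_trans (remove_ribbon_le mu_sorted lt_m r) _; case/andP: (mu_bnd r).
Qed.

Lemma isbP P : reflect P (isb P).
Proof. by rewrite /isb; case: excluded_middle_informative => ?; constructor. Qed.

Lemma perm_ribbons n k mu i : in_box n k mu ->
  perm_eq [seq lam <- boxparts n k | isb (ribbon_head_row k mu lam i.+1)]
          [seq remove_ribbon i m mu | m <- iota 0 (nth 0 mu i)].
Proof.
move=> mu_box; have /and3P[/eqP size_mu _ mu_sorted] := mu_box.
apply: uniq_perm; first exact/filter_uniq/boxparts_uniq.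
  rewrite map_inj_in_uniq ?iota_uniq // => m m'; rewrite !mem_iota => lt_m lt_m'.
  exact: remove_ribbon_inj.
move=> lam; rewrite mem_filter mem_boxparts; apply/andP/mapP => [[/isbP rib lam_box]|[m]].
  have /and3P[/eqP size_lam _ lam_sorted] := lam_box.
  have [m lt_m ->] := ribbon_head_row_remove_ribbon rib size_mu mu_sorted lam_sorted size_lam.
  by exists m; rewrite ?mem_iota.
rewrite mem_iota => lt_m ->; split; last exact: in_box_remove_ribbon.
by apply/isbP/ribbon_remove_ribbon; rewrite ?size_mu.
Qed.

(** * Grassmannian permutations *)

Definition wnu_top (k : nat) (nu : seq nat) : seq nat :=
  [seq nth 0 nu (k - a).-1 + a.+1 | a <- iota 0 k].

Lemma wnuE n k nu :
  wnu n k nu = wnu_top k nu ++ [seq v <- iota 1 n | v \notin wnu_top k nu].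
Proof. by []. Qed.

Lemma wnu_top_inj k nu : sorted geq nu ->
  {in gtn k &, injective (fun a => nth 0 nu (k - a).-1 + a.+1)}.
Proof.
move=> nu_sorted a b; rewrite !inE => lt_a lt_b eq_ab.
have := @sorted_geq_nth nu (k - b).-1 (k - a).-1 nu_sorted.
by have := @sorted_geq_nth nu (k - a).-1 (k - b).-1 nu_sorted; lia.
Qed.

Lemma perm_wnu n k nu : k <= n -> in_box n k nu -> perm_eq (wnu n k nu) (iota 1 n).
Proof.
move=> le_kn nu_box; have /and3P[_ _ nu_sorted] := nu_box.
have /in_boxP[_ nu_bnd] := nu_box.
have top_iota v : v \in wnu_top k nu -> v \in iota 1 n.
  by move=> /mapP[a]; rewrite !mem_iota => lt_a ->; have := nu_bnd (k - a).-1; lia.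
apply: uniq_perm; rewrite ?iota_uniq //.
  rewrite wnuE cat_uniq filter_uniq ?iota_uniq // andbT; apply/andP; split.
    rewrite map_inj_in_uniq ?iota_uniq // => a b; rewrite !mem_iota.
    exact: wnu_top_inj.
  by apply/hasPn => v; rewrite mem_filter => /andP[].
move=> v; rewrite wnuE mem_cat mem_filter.
by case: (boolP (v \in wnu_top k nu)) => //= /top_iota ->.
Qed.

Lemma wnu_nseq0 n k : k <= n -> wnu n k (nseq k 0) = iota 1 n.
Proof.
move=> le_kn; have top : wnu_top k (nseq k 0) = iota 1 k.
  by rewrite (iotaDl 1 0); apply/eq_map => a; rewrite nth_nseq if_same.
rewrite wnuE top -(subnKC le_kn) iotaD filter_cat; congr (_ ++ _).
rewrite (eq_in_filter (a2 := pred0)) => [|v ->] //; rewrite filter_pred0 cat0s.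
by apply/all_filterP/allP => v; rewrite !mem_iota; lia.
Qed.

Lemma map_adjswap_id l s : l \notin s -> l.+1 \notin s -> map (adjswap l) s = s.
Proof.
move=> l_s lS_s; apply: map_id_in => v v_s.
by apply: adjswap_id; [apply: contraNneq l_s | apply: contraNneq lS_s] => <-.
Qed.

Lemma iota1_split l n : 0 < l < n ->
  iota 1 n = iota 1 l.-1 ++ l :: l.+1 :: iota l.+2 (n - l.+1).
Proof.
move=> lt_l; rewrite {1}(_ : n = l.-1 + (2 + (n - l.+1))); last by lia.
by rewrite iotaD add1n prednK; last by lia.
Qed.

Lemma filter_adjswap l n (P : pred nat) : 0 < l < n -> ~~ P l -> P l.+1 ->
  [seq v <- iota 1 n | P (adjswap l v)] = map (adjswap l) (filter P (iota 1 n)).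
Proof.
move=> lt_l notPl PlS.
rewrite (iota1_split lt_l) -[l :: l.+1 :: _]/([:: l; l.+1] ++ _) !filter_cat !map_cat.
have filter_id s : l \notin s -> l.+1 \notin s ->
    [seq v <- s | P (adjswap l v)] = map (adjswap l) (filter P s).
  move=> l_s lS_s; rewrite map_adjswap_id ?mem_filter ?negb_and ?l_s ?lS_s ?orbT //.
  apply: eq_in_filter => v v_s.
  by rewrite adjswap_id //; [apply: contraNneq l_s | apply: contraNneq lS_s] => <-.
rewrite (filter_id (iota 1 _)) ?(filter_id (iota l.+2 _)) ?mem_iota; try lia.
by rewrite /= adjswapL adjswapR PlS (negbTE notPl) /= adjswapR.
Qed.

Lemma in_box_shorten_row n k (u : seq nat) m m' z : m <= m' ->
  in_box n k (u ++ m' :: nseq z 0) -> in_box n k (u ++ m :: nseq z 0).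
Proof.
move=> le_m /and3P[sz bnd u_sorted]; apply/and3P; split.
- by move: sz; rewrite !size_cat.
- by move: bnd; rewrite !all_cat /= => /and3P[-> /(leq_trans le_m)-> ->].
move: u_sorted; rewrite !(sorted_pairwise (rev_trans leq_trans)) !pairwise_cat /=.
rewrite !allrel_consr => /and3P[/andP[le_u ->] -> /andP[_ ->]]; rewrite /= !andbT.
apply/andP; split; first by apply: sub_all le_u => c; apply: leq_trans.
by apply/allP => c /nseqP[->].
Qed.

Section AddBox.
Variables (k j : nat) (mu : seq nat).
Hypothesis lt_j : j < k.
Let l := nth 0 mu j + (k - j).

Lemma mem_wnu_top_add_box : l \in wnu_top k mu.
Proof.
by apply/mapP; exists (k - j).-1; [rewrite mem_iota; lia | rewrite (_ : _.-1 = j) /l; lia].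
Qed.

Hypotheses (mu_sorted : sorted geq mu) (add_sorted : sorted geq (incr_nth mu j)).

Lemma wnu_top_add_box : wnu_top k (incr_nth mu j) = map (adjswap l) (wnu_top k mu).
Proof.
rewrite -map_comp; apply/eq_in_map => a; rewrite mem_iota /= => lt_a.
have := @sorted_geq_nth _ (k - a).-1 j add_sorted.
have := @sorted_geq_nth _ j (k - a).-1 mu_sorted.
rewrite !nth_incr_nth eqxx /l; have [eq_a|ne_a] := eqVneq j (k - a).-1; rewrite -?eq_a;
  adjswap_lia.
Qed.

Lemma notin_wnu_top_add_box : l.+1 \notin wnu_top k mu.
Proof.
apply/mapP => -[a]; rewrite mem_iota /l => lt_a.
have := @sorted_geq_nth _ (k - a).-1 j add_sorted.
have := @sorted_geq_nth _ j (k - a).-1 mu_sorted.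
rewrite !nth_incr_nth eqxx; have [eq_a|ne_a] := eqVneq j (k - a).-1; rewrite -?eq_a; lia.
Qed.

Lemma index_wnu_add_box n : index l (wnu n k mu) < index l.+1 (wnu n k mu).
Proof.
rewrite wnuE !index_cat mem_wnu_top_add_box (negbTE notin_wnu_top_add_box).
by rewrite (leq_trans _ (leq_addr _ _)) // index_mem mem_wnu_top_add_box.
Qed.

Lemma wnu_add_box n : 0 < l < n -> wnu n k (incr_nth mu j) = map (adjswap l) (wnu n k mu).
Proof.
move=> lt_l; rewrite !wnuE map_cat wnu_top_add_box; congr (_ ++ _).
rewrite -filter_adjswap ?negbK ?mem_wnu_top_add_box ?notin_wnu_top_add_box //.
apply: eq_filter => v; rewrite -{1}(adjswapK l v) mem_map //; exact: adjswap_inj.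
Qed.

End AddBox.

(** * The Young subgroup *)

Definition young (n k : nat) : seq (seq nat) :=
  [seq a ++ b | a <- permutations (iota 1 k), b <- permutations (iota k.+1 (n - k))].

Lemma mem_young n k v : (v \in young n k) =
  perm_eq (take k v) (iota 1 k) && perm_eq (drop k v) (iota k.+1 (n - k)).
Proof.
apply/allpairsP/andP => [[[a b] /=]|[a_perm b_perm]].
  rewrite !mem_permutations => -[a_perm b_perm ->].
  by rewrite take_size_cat ?drop_size_cat ?(perm_size a_perm) ?size_iota.
by exists (take k v, drop k v); rewrite !mem_permutations cat_take_drop.
Qed.

Lemma young_uniq n k : uniq (young n k).
Proof.
apply: allpairs_uniq; rewrite ?permutations_uniq // => -[a b] [c d].
case/allpairsP => -[a' b'] /= [a_perm _ [-> ->]].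
case/allpairsP => -[c' d'] /= [c_perm _ [-> ->]] /eqP.
rewrite !mem_permutations in a_perm c_perm.
by rewrite eqseq_cat ?(perm_size a_perm) ?(perm_size c_perm) // => /andP[/eqP-> /eqP->].
Qed.

Lemma perm_map_adjswap_iota l m r :
  (l.+1 < m) || (m <= l) && (l.+1 < m + r) || (m + r <= l) ->
  perm_eq (map (adjswap l) (iota m r)) (iota m r).
Proof.
move=> l_out; have inj := @adjswap_inj l.
apply: uniq_perm; rewrite ?(map_inj_uniq inj) ?iota_uniq // => v.
rewrite -{1}(adjswapK l v) mem_map //.
by rewrite !mem_iota; adjswap_lia.
Qed.

Lemma young_map_adjswap n k l v : 0 < l < n -> l != k -> v \in young n k ->
  map (adjswap l) v \in young n k.
Proof.
move=> lt_l ne_k; rewrite !mem_young -map_take -map_drop => /andP[a_perm b_perm].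
apply/andP; split.
  by apply: perm_trans (perm_map _ a_perm) (perm_map_adjswap_iota _); lia.
by apply: perm_trans (perm_map _ b_perm) (perm_map_adjswap_iota _); lia.
Qed.

Section Young.
Variables (n k : nat).
Hypothesis le_kn : k <= n.

Lemma young_perm v : v \in young n k -> perm_eq v (iota 1 n).
Proof.
rewrite mem_young => /andP[a_perm b_perm].
rewrite -(cat_take_drop k v) -(subnKC le_kn) iotaD.
exact: perm_cat.
Qed.

Lemma young_separated v : v \in young n k -> separated k v.
Proof.
move=> v_young s t lt_s /andP[le_t lt_t].
have size_v : size v = n by rewrite (perm_size (young_perm v_young)) size_iota.
move: v_young; rewrite mem_young => /andP[a_perm b_perm].
have s_iota : nth 0 v s \in iota 1 k.
  by rewrite -(perm_mem a_perm) -(nth_take 0 lt_s) mem_nth // (perm_size a_perm) size_iota.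
have t_iota : nth 0 v t \in iota k.+1 (n - k).
  rewrite -(perm_mem b_perm) -(subnKC le_t) -nth_drop mem_nth //.
  rewrite (perm_size b_perm) size_iota.
  by rewrite ltn_sub2r // -size_v; apply: leq_ltn_trans lt_t.
by move: s_iota t_iota; rewrite !mem_iota; lia.
Qed.

Lemma young_perm_len v : v \in young n k -> perm_len v <= dd n k.
Proof.
move=> v_young; have := young_separated v_young; move: v_young.
rewrite mem_young -{3}(cat_take_drop k v) => /andP[/perm_size a_size /perm_size b_size].
rewrite !size_iota in a_size b_size; rewrite -{1}a_size => sep_v.
rewrite -(cat_take_drop k v) perm_len_cat //; apply: leq_add.
  by have := perm_len_le_bin (take k v); rewrite a_size.
by have := perm_len_le_bin (drop k v); rewrite b_size.
Qed.

End Young.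

Local Open Scope ring_scope.

(** * Hecke relations *)

Definition central (A : pzRingType) (z : A) : Prop := forall y, GRing.comm z y.

Lemma centralB (A : pzRingType) (z u : A) : central z -> central u -> central (z - u).
Proof. by move=> zC uC y; apply/commr_sym/commrB; apply/commr_sym. Qed.

Lemma centralM (A : pzRingType) (z u : A) : central z -> central u -> central (z * u).
Proof. by move=> zC uC y; apply/commr_sym/commrM; apply/commr_sym. Qed.

Lemma centralX (A : pzRingType) (z : A) m : central z -> central (z ^+ m).
Proof. by move=> zC y; apply/commr_sym/commrX/commr_sym. Qed.

Lemma central_sum (A : pzRingType) I (r : seq I) (P : pred I) (F : I -> A) :
  (forall i, P i -> central (F i)) -> central (\sum_(i <- r | P i) F i).
Proof. by move=> FC y; apply/commr_sym/commr_sum => i Pi; apply/commr_sym/FC. Qed.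

Lemma central_prod (A : pzRingType) I (r : seq I) (P : pred I) (F : I -> A) :
  (forall i, P i -> central (F i)) -> central (\prod_(i <- r | P i) F i).
Proof. by move=> FC y; apply/commr_sym/commr_prod => i Pi; apply/commr_sym/FC. Qed.

Lemma central_mulrCA (A : pzRingType) (z y u : A) : central z -> y * (z * u) = z * (y * u).
Proof. by move=> zC; rewrite mulrA -zC mulrA. Qed.

Lemma central_inv (A : pzRingType) (z u : A) :
  central z -> u * z = 1 -> z * u = 1 -> central u.
Proof.
move=> zC uz zu y.
by rewrite /GRing.comm -[y in LHS]mulr1 -zu (central_mulrCA _ _ zC) mulrA uz mul1r.
Qed.

Record braid_relations (A : pzRingType) (n : nat) (t : nat -> A) : Prop := {
  braid_adj : forall i, (0 < i)%N -> (i.+1 < n)%N ->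
    t i * t i.+1 * t i = t i.+1 * t i * t i.+1;
  braid_far : forall i j, (0 < i)%N -> (i.+1 < j < n)%N -> GRing.comm (t i) (t j)
}.

Record hecke_relations (A : pzRingType) (n : nat) (p q : A) (t : nat -> A) : Prop := {
  hecke_braid :> braid_relations n t;
  hecke_p_central : central p;
  hecke_q_central : central q;
  hecke_quad : forall i, (0 < i < n)%N -> (t i - p) * (t i + q) = 0
}.

Record affine_hecke_relations (A : pzRingType) (n : nat) (p q hb : A)
    (t x : nat -> A) : Prop := {
  affine_hecke :> hecke_relations n p q t;
  affine_hb_central : central hb;
  affine_xC : forall i j, (0 < i <= n)%N -> (0 < j <= n)%N -> GRing.comm (x i) (x j);
  affine_tx_far : forall i j, (0 < i < n)%N -> (0 < j <= n)%N -> j != i -> j != i.+1 ->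
    GRing.comm (t i) (x j);
  affine_tx : forall i, (0 < i < n)%N ->
    t i * x i = x i.+1 * t i + (hb - (p - q) * x i.+1);
  affine_txS : forall i, (0 < i < n)%N ->
    t i * x i.+1 = x i * t i - (hb - (p - q) * x i.+1)
}.

Definition absorbs (A : pzRingType) (p : A) (t : nat -> A) (P : pred nat) (Z : A) : Prop :=
  forall l, P l -> t l * Z = p * Z.

Lemma absorbs_mul (A : pzRingType) (p : A) (t : nat -> A) (P : pred nat) (y Z : A) :
  central p -> (forall l, P l -> GRing.comm y (t l)) -> absorbs p t P Z ->
  absorbs p t P (y * Z).
Proof. by move=> pC ytC tZ l Pl; rewrite mulrA -ytC // -mulrA tZ // central_mulrCA. Qed.

Section ReducedProducts.
Variables (A : pzRingType) (n : nat) (t : nat -> A).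
Hypothesis t_braid : braid_relations n t.
Implicit Types w : seq nat.

Definition prod_red (w : seq nat) : A := \prod_(i <- redword w) t i.

Lemma prod_red_first_descent w (j := first_descent w) : descent w j ->
  prod_red w = prod_red (swapw w j) * t j.+1.
Proof. by rewrite /prod_red redwordE => ->; rewrite -cats1 big_cat big_seq1. Qed.

Definition peels_descents (w : seq nat) : Prop :=
  forall j, descent w j -> prod_red w = prod_red (swapw w j) * t j.+1.

Lemma prod_red_swapw_far w i j : (size w <= n)%N -> (i.+1 < j)%N ->
  descent w i -> descent w j ->
  peels_descents (swapw w i) -> peels_descents (swapw w j) ->
  prod_red (swapw w i) * t i.+1 = prod_red (swapw w j) * t j.+1.
Proof.
move=> le_wn lt_ij /andP[lt_i desc_i] /andP[lt_j desc_j] peel_i peel_j.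
rewrite (peel_i j); last by rewrite /descent size_swapw lt_j !nth_swapw //; adjswap_lia.
rewrite (peel_j i); last by rewrite /descent size_swapw lt_i !nth_swapw //; adjswap_lia.
by rewrite swapw_far // -!mulrA (braid_far t_braid (i := i.+1)) //; lia.
Qed.

Lemma prod_red_swapw_adj w i : (size w <= n)%N -> descent w i -> descent w i.+1 ->
  (forall v, size v = size w -> (perm_len v < perm_len w)%N -> peels_descents v) ->
  prod_red (swapw w i) * t i.+1 = prod_red (swapw w i.+1) * t i.+2.
Proof.
move=> le_wn desc_i desc_iS peel.
have [[_ lt_nth] [lt_i lt_nthS]] := (andP desc_i, andP desc_iS).
have peel_swap v j : size v = size w -> (perm_len v <= perm_len w)%N -> descent v j ->
    peels_descents (swapw v j).
  move=> sz le_v desc_j; apply: peel; first by rewrite size_swapw.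
  by rewrite (perm_len_swapw desc_j) in le_v.
have desc_i_iS : descent (swapw w i) i.+1.
  by rewrite /descent size_swapw lt_i !nth_swapw //; adjswap_lia.
have desc_i_iS_i : descent (swapw (swapw w i) i.+1) i.
  by rewrite /descent !size_swapw !nth_swapw ?size_swapw //; adjswap_lia.
have desc_iS_i : descent (swapw w i.+1) i.
  by rewrite /descent size_swapw !nth_swapw //; adjswap_lia.
have desc_iS_i_iS : descent (swapw (swapw w i.+1) i) i.+1.
  by rewrite /descent !size_swapw lt_i !nth_swapw ?size_swapw //; adjswap_lia.
have len_i := perm_len_swapw desc_i; have len_iS := perm_len_swapw desc_iS.
rewrite (peel_swap w i _ _ _ _ desc_i_iS) //.
rewrite (peel_swap (swapw w i) i.+1 _ _ _ _ desc_i_iS_i) ?size_swapw ?len_i //.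
rewrite (peel_swap w i.+1 _ _ _ _ desc_iS_i) //.
rewrite (peel_swap (swapw w i.+1) i _ _ _ _ desc_iS_i_iS) ?size_swapw ?len_iS //.
rewrite swapw_braid // -!mulrA; congr (_ * _).
by rewrite !mulrA (braid_adj t_braid) //; lia.
Qed.

Lemma prod_red_swapw w j : (size w <= n)%N -> descent w j ->
  prod_red w = prod_red (swapw w j) * t j.+1.
Proof.
have [N] := ubnP (perm_len w); elim: N w j => // N IH w j lt_N le_wn desc_j.
have desc_i := descent_first desc_j; rewrite (prod_red_first_descent desc_i).
move: (first_descent w) desc_i (first_descent_le desc_j) => i desc_i le_ij.
have peel v : size v = size w -> (perm_len v < perm_len w)%N -> peels_descents v.
  by move=> sz lt_v s; apply: IH; rewrite ?sz //; lia.
have peel_swap s : descent w s -> peels_descents (swapw w s).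
  by move=> desc_s; apply: peel; rewrite ?size_swapw // (perm_len_swapw desc_s).
case: (ltngtP i.+1 j) => [lt_ij|gt_ij|eq_ij].
- by apply: prod_red_swapw_far => //; apply: peel_swap.
- by have -> : i = j by lia.
by rewrite -eq_ij in desc_j *; apply: prod_red_swapw_adj.
Qed.

Lemma prod_red_iota m r : prod_red (iota m r) = 1.
Proof.
rewrite /prod_red redword_nil ?big_nil // => j; rewrite /descent size_iota.
by apply/andP => -[lt_j]; rewrite !nth_iota; lia.
Qed.

Lemma prod_red_map_adjswap w l : (0 < l < n)%N -> perm_eq w (iota 1 n) ->
  (index l w < index l.+1 w)%N -> prod_red (map (adjswap l) w) = t l * prod_red w.
Proof.
move=> lt_l; elim/descent_ind: w => [w ndesc_w|w j desc_j IH] w_perm lt_idx.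
  rewrite (no_descent_iota w_perm ndesc_w) prod_red_iota mulr1.
  rewrite (prod_red_swapw _ (adjswap_iota_descent lt_l)) ?size_map ?size_iota //.
  by rewrite swapw_adjswap_iota // prod_red_iota mul1r prednK //; case/andP: lt_l.
have [lt_j _] := andP desc_j.
have size_w : size w = n by rewrite (perm_size w_perm) size_iota.
have uw : uniq w by rewrite (perm_uniq w_perm) iota_uniq.
have desc_lj := descent_map_adjswap uw lt_idx desc_j.
rewrite (prod_red_swapw _ desc_lj) ?size_map ?size_w // -map_adjswap_swapw // IH.
- by rewrite (prod_red_swapw _ desc_j) ?size_w // mulrA.
- exact: perm_trans (perm_swapw lt_j) w_perm.
exact: (index_swapw_lt lt_l).
Qed.

End ReducedProducts.

(** * The products of the rows of a partition *)

Section Rows.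
Variables (A : pzRingType) (t : nat -> A).

Fixpoint row_prod (a m : nat) : A := if m is m'.+1 then t (a + m')%N * row_prod a m' else 1.

(* The rows of [u] are listed from top to bottom; the bottom one starts at [b.+1]. *)
Fixpoint shape_prod (b : nat) (u : seq nat) : A :=
  if u is c :: u' then shape_prod b u' * row_prod (b + size u').+1 c else 1.

Lemma row_prodS a m : row_prod a m.+1 = t (a + m)%N * row_prod a m.
Proof. by []. Qed.

Lemma row_prodSr a m : row_prod a m.+1 = row_prod a.+1 m * t a.
Proof.
elim: m => [|m IH]; first by rewrite /= addn0 mulr1 mul1r.
by rewrite row_prodS IH mulrA /= addSnnS.
Qed.

Lemma row_prod_comm y a m : (forall l, (a <= l < a + m)%N -> GRing.comm y (t l)) ->
  GRing.comm y (row_prod a m).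
Proof.
elim: m => [|m IH] ytC; first exact: commr1.
by apply: commrM; [apply: ytC; lia|apply: IH => l lt_l; apply: ytC; lia].
Qed.

Lemma shape_prod_comm y b u M : all (fun c => c <= M)%N u ->
  (forall l, (b < l < b + size u + M)%N -> GRing.comm y (t l)) ->
  GRing.comm y (shape_prod b u).
Proof.
elim: u => [_ _|c u IH /= /andP[le_c le_u] ytC]; first exact: commr1.
apply: commrM; first by apply: IH => // l lt_l; apply: ytC; lia.
by apply: row_prod_comm => l lt_l; apply: ytC; lia.
Qed.

Lemma shape_prod_cat b u s :
  shape_prod b (u ++ s) = shape_prod b s * shape_prod (b + size s) u.
Proof.
elim: u => [|c u IH] /=; first by rewrite mulr1.
by rewrite IH mulrA size_cat -addnA (addnC (size u)).
Qed.

Lemma shape_prod_split b i mu : (i < size mu)%N ->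
  shape_prod b mu = shape_prod b (drop i.+1 mu) *
    row_prod (b + (size mu - i)) (nth 0%N mu i) *
    shape_prod (b + (size mu - i)) (take i mu).
Proof.
move=> lt_i; rewrite -[in LHS](cat_take_drop i mu) (drop_nth 0%N lt_i) shape_prod_cat /=.
by rewrite size_drop subnSK // -addnS subnSK.
Qed.

Lemma shape_prod_remove_ribbon b i m mu : (i < size mu)%N ->
  shape_prod b (remove_ribbon i m mu) =
  shape_prod b (insert_row m (drop i.+1 mu)) * shape_prod (b + (size mu - i)) (take i mu).
Proof. by move=> lt_i; rewrite shape_prod_cat size_insert_row size_drop subnSK. Qed.

Lemma shape_prod_drop_comm y b i mu : sorted geq mu -> (i < size mu)%N ->
  (forall l, (b < l < (b + (size mu - i) + nth 0 mu i).-1)%N -> GRing.comm y (t l)) ->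
  GRing.comm y (shape_prod b (drop i.+1 mu)).
Proof.
move=> mu_sorted lt_i ytC; apply: (@shape_prod_comm _ _ _ (nth 0 mu i)%N).
  by apply/(all_nthP 0%N) => r _; rewrite nth_drop; apply: sorted_geq_nth => //; lia.
by move=> l; rewrite size_drop => lt_l; apply: ytC; lia.
Qed.

Variable n : nat.
Hypothesis t_braid : braid_relations n t.

Lemma prod_red_wnu_row k (u : seq nat) z m :
  (k <= n)%N -> in_box n k (u ++ m :: nseq z 0) ->
  prod_red t (wnu n k (u ++ m :: nseq z 0)) =
  row_prod z.+1 m * prod_red t (wnu n k (u ++ nseq z.+1 0)).
Proof.
move=> le_kn; elim: m => [|m IH] box_mS; first by rewrite mul1r.
have box_m : in_box n k (u ++ m :: nseq z 0) := in_box_shorten_row (leqnSn m) box_mS.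
have incr_m : u ++ m.+1 :: nseq z 0 = incr_nth (u ++ m :: nseq z 0) (size u).
  by elim: u {box_m box_mS IH} => //= c u ->.
have size_u : (size u + z.+1 = k)%N.
  by case/and3P: box_m => /eqP <-; rewrite size_cat /= size_nseq.
have lt_u : (size u < k)%N by lia.
have [[_ _ sorted_m] [_ bnd_mS sorted_mS]] := (and3P box_m, and3P box_mS).
have lt_m : (0 < m + z.+1 < n)%N by move: bnd_mS; rewrite all_cat /=; lia.
have l_eq : (nth 0 (u ++ m :: nseq z 0) (size u) + (k - size u) = m + z.+1)%N.
  by rewrite nth_cat ltnn subnn /=; lia.
rewrite incr_m in sorted_mS *.
rewrite (wnu_add_box lt_u) // l_eq // (prod_red_map_adjswap t_braid) ?perm_wnu //.
  by rewrite IH // row_prodS mulrA addnC.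
by rewrite -l_eq; apply: index_wnu_add_box.
Qed.

Lemma prod_red_wnu_cat k (u : seq nat) z : (k <= n)%N -> in_box n k (u ++ nseq z 0) ->
  prod_red t (wnu n k (u ++ nseq z 0)) = shape_prod z u.
Proof.
move=> le_kn; elim/last_ind: u z => [|u c IH] z.
  by case/and3P=> /eqP; rewrite size_nseq => -> _ _; rewrite wnu_nseq0 // prod_red_iota.
rewrite cat_rcons => box_c; rewrite prod_red_wnu_row // IH.
  by rewrite -cats1 shape_prod_cat /= mul1r addn0 addn1.
exact: in_box_shorten_row box_c.
Qed.

Lemma prod_red_wnu k mu : (k <= n)%N -> in_box n k mu ->
  prod_red t (wnu n k mu) = shape_prod 0 mu.
Proof.
by move=> le_kn mu_box; have := @prod_red_wnu_cat k mu 0 le_kn; rewrite cats0; apply.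
Qed.

Lemma t_row_prod a m l : (0 < a <= l)%N -> (l.+1 < a + m <= n)%N ->
  t l * row_prod a m = row_prod a m * t l.+1.
Proof.
move=> le_l; elim: m => [|m IH] lt_l; first by lia.
rewrite row_prodS; have [lt_lm|ge_lm] := ltnP l.+1 (a + m).
  by rewrite mulrA (braid_far t_braid (i := l)) -?mulrA ?IH //; lia.
case: m IH lt_l ge_lm => [|m] IH lt_l ge_lm; first by lia.
rewrite row_prodS (_ : l = a + m)%N; last by lia.
rewrite addnS !mulrA (braid_adj t_braid) -?mulrA; [|lia|lia].
congr (_ * (_ * _)); apply: row_prod_comm => r lt_r.
by apply/commr_sym/(braid_far t_braid); lia.
Qed.

Lemma row_prod_exchange a c m : (0 < a)%N -> (m < c)%N -> (a + c <= n)%N ->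
  row_prod a c * row_prod a.+1 m = row_prod a m * row_prod a c.
Proof.
move=> gt_a lt_m le_n; elim: m lt_m => [|m IH] lt_m; first by rewrite mulr1 mul1r.
by rewrite !row_prodS mulrA addSn -t_row_prod -?mulrA ?IH //; lia.
Qed.

Lemma t_shape_prod a c u l : (0 < a)%N -> all (fun d => c <= d)%N u ->
  all (fun d => a + size u + d <= n)%N u -> (a < l < a + c)%N ->
  t l * shape_prod a u = shape_prod a u * t (l + size u)%N.
Proof.
move=> gt_a; elim: u => [|d u IH] /=; first by rewrite addn0 mulr1 mul1r.
move=> /andP[le_d le_u] /andP[le_dn le_un] lt_l.
rewrite mulrA IH //; last by apply: sub_all le_un => e; lia.
by rewrite -!mulrA t_row_prod ?addnS //; lia.
Qed.

Variable p : A.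
Hypothesis pC : central p.

(* Exchanging a short row with a longer one below it releases a letter, absorbed by [Z]. *)
Lemma shape_prod_insert b s m M Z : sorted geq s -> all (fun c => c <= M)%N s ->
  (b + size s + M <= n)%N -> absorbs p t (fun l => b < l <= b + size s)%N Z ->
  shape_prod b s * (row_prod (b + size s).+1 m * Z) =
  p ^+ nrows_gt m s * (shape_prod b (insert_row m s) * Z).
Proof.
elim: s Z => [|c s IH] Z s_sorted; first by move=> _ _ _; rewrite /= !mul1r.
rewrite /= addnS => /andP[le_c le_s] le_n tZ; set a := (b + size s).+1.
have [lt_m|ge_m] := ltnP m c; last first.
  have -> : nrows_gt m (c :: s) = 0%N.
    by apply/eqP; rewrite -leqn0 leqNgt lt_nrows_gt //= -leqNgt.
  by rewrite mul1r /= addnS -[RHS]mulrA.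
rewrite nrows_gt_cons lt_m add1n exprS /= size_insert_row addnS -/a.
rewrite -[LHS]mulrA [X in _ * X]mulrA row_prod_exchange; [|lia..].
case: c s_sorted lt_m le_c => // c s_sorted lt_m le_c.
rewrite row_prodSr -!mulrA tZ; last by lia.
rewrite !(central_mulrCA _ _ pC); congr (p * _).
rewrite IH ?(path_sorted s_sorted) //; first by lia.
apply: absorbs_mul => // [l lt_l|l lt_l]; last by apply: tZ; lia.
by apply/commr_sym/row_prod_comm => r lt_r; apply: (braid_far t_braid); lia.
Qed.

Lemma absorbs_shape_prod_take k i mu Z : (k <= n)%N -> (i < k)%N -> in_box n k mu ->
  absorbs p t (fun l => (0 < l < k - i) || (k < l < n))%N Z ->
  absorbs p t (fun l => (0 < l < k - i) || (k - i < l < k - i + nth 0 mu i))%N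
    (shape_prod (k - i) (take i mu) * Z).
Proof.
move=> le_kn lt_i /and3P[/eqP size_mu mu_le mu_sorted] tZ.
have mu_i_le : (nth 0 mu i <= n - k)%N by apply: (all_nthP 0%N mu_le); rewrite size_mu.
have size_upper : size (take i mu) = i by rewrite size_takel // size_mu ltnW.
have upper_le : all (fun d => d <= n - k)%N (take i mu).
  by apply/allP => d /mem_take/(allP mu_le).
have upper_ge : all (fun d => nth 0 mu i <= d)%N (take i mu).
  apply/(all_nthP 0%N) => r; rewrite size_upper => lt_r.
  by rewrite nth_take //; apply: sorted_geq_nth => //; apply: ltnW.
move=> l /orP[lt_l|gt_l]; rewrite mulrA.
  rewrite (shape_prod_comm upper_le) => [|r].
    by rewrite -mulrA tZ ?lt_l // (central_mulrCA _ _ pC).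
  by rewrite size_upper => lt_r; apply: (braid_far t_braid); lia.
rewrite (t_shape_prod _ upper_ge _ gt_l) ?size_upper; first last.
- by apply: sub_all upper_le => d; lia.
- by lia.
by rewrite -mulrA tZ ?(central_mulrCA _ _ pC) //; lia.
Qed.

End Rows.

(** * Symmetrizers *)

Section Symmetrizer.
Variables (A : pzRingType) (n : nat) (p q : A) (t : nat -> A).
Hypothesis t_hecke : hecke_relations n p q t.

Definition qlen_sum (d : nat) (L : seq (seq nat)) : A :=
  \sum_(v <- L) q ^+ (d - perm_len v) * prod_red t v.

Section Absorption.
Variables (d l : nat) (L : seq (seq nat)).
Hypotheses (l_lt : (0 < l < n)%N) (L_uniq : uniq L).
Hypothesis L_perm : forall v, v \in L -> perm_eq v (iota 1 n).
Hypothesis L_len : forall v, v \in L -> (perm_len v <= d)%N.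
Hypothesis L_adjswap : forall v, v \in L -> map (adjswap l) v \in L.

Lemma qlen_sum_pairs : qlen_sum d L =
  \sum_(v <- L | (index l v < index l.+1 v)%N)
    q ^+ (d - perm_len v).-1 * ((t l + q) * prod_red t v).
Proof.
have adjK := mapK (adjswapK l).
have L_perm_adj : perm_eq (map (map (adjswap l)) L) L.
  apply: uniq_perm; rewrite ?(map_inj_uniq (can_inj adjK)) // => v.
  rewrite -{1}(adjK v) mem_map; last exact: can_inj adjK.
  by apply/idP/idP => /L_adjswap; rewrite ?adjK.
rewrite /qlen_sum (bigID (fun v => index l v < index l.+1 v)%N) /= addrC.
rewrite -[X in X + _](perm_big _ L_perm_adj) big_map /= big_seq_cond.
rewrite (eq_bigl (fun v => (v \in L) && (index l v < index l.+1 v)%N)) => [|v]; last first.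
  by case v_L: (v \in L); rewrite //= (index_map_adjswap_lt l_lt) ?negbK //; apply: L_perm.
rewrite -big_seq_cond -big_split /= big_seq_cond [RHS]big_seq_cond.
apply: eq_bigr => v /andP[v_L lt_idx]; have v_perm := L_perm v_L.
have len_v := perm_len_map_adjswap l_lt v_perm lt_idx.
have := L_len (L_adjswap v_L); rewrite len_v => lt_d.
rewrite (prod_red_map_adjswap t_hecke l_lt v_perm lt_idx) subnS.
by rewrite -[(d - _)%N in X in _ + X]prednK ?subn_gt0 // exprSr -!mulrA -mulrDr -mulrDl.
Qed.

Lemma t_qlen_sum : t l * qlen_sum d L = p * qlen_sum d L.
Proof.
have t_quad : t l * (t l + q) = p * (t l + q).
  by apply/subr0_eq; rewrite -mulrBl (hecke_quad t_hecke).
rewrite qlen_sum_pairs !mulr_sumr; apply: eq_bigr => v _.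
rewrite !(central_mulrCA _ _ (centralX _ (hecke_q_central t_hecke))).
by congr (_ * _); rewrite !mulrA t_quad.
Qed.

End Absorption.

Variable k : nat.
Hypothesis le_kn : (k <= n)%N.

Definition young_sym : A := qlen_sum (dd n k) (young n k).

Lemma absorbs_young_sym : absorbs p t (fun l => (0 < l < n) && (l != k))%N young_sym.
Proof.
move=> l /andP[lt_l ne_k]; apply: t_qlen_sum => //; first exact: young_uniq.
- by move=> v; apply: young_perm.
- by move=> v; apply: young_perm_len.
by move=> v; apply: young_map_adjswap.
Qed.

Lemma young_sym_comm y : (forall l, (0 < l < n)%N -> l != k -> GRing.comm y (t l)) ->
  GRing.comm y young_sym.
Proof.
move=> ytC; rewrite /young_sym /qlen_sum big_seq; apply: commr_sum => v v_young.
apply: commrM; first exact/commr_sym/(centralX _ (hecke_q_central t_hecke)).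
rewrite /prod_red big_seq; apply: commr_prod => l l_red; apply: ytC.
  by have := mem_redword l_red; rewrite (perm_size (young_perm le_kn v_young)) size_iota.
exact: redword_separated (young_separated le_kn v_young) l_red.
Qed.

End Symmetrizer.

(** * Moving a variable through the rows *)

Section AffineHecke.
Variables (A : pzRingType) (n : nat) (p q hb : A) (t x : nat -> A).
Hypothesis t_affine : affine_hecke_relations n p q hb t x.

Let pC : central p := hecke_p_central t_affine.
Let qC : central q := hecke_q_central t_affine.
Let hbC : central hb := affine_hb_central t_affine.
Let t_braid : braid_relations n t := t_affine.

Definition cross (j : nat) : A := hb - (p - q) * x j.

Lemma cross_comm y j : GRing.comm y (x j) -> GRing.comm y (cross j).
Proof.
move=> yxC; apply: commrB; first exact/commr_sym/hbC.
by apply: commrM => //; apply/commr_sym/(centralB pC qC).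
Qed.

Lemma t_cross i : (0 < i < n)%N -> t i * cross i = cross i.+1 * (t i - (p - q)).
Proof.
move=> lt_i; have pqC := centralB pC qC.
rewrite [LHS]mulrBr (central_mulrCA _ _ pqC) (affine_tx t_affine) // -/(cross i.+1) -hbC.
by rewrite mulrDr opprD addrA mulrA -mulrBl (pqC (cross _)) -mulrBr.
Qed.

(* At each letter [x] either crosses over or leaves [cross] behind; in the latter case
   the letters passed afterwards become [t l - (p - q)], which act on [W] as [q]. *)
Lemma row_prod_mulx a m W : (0 < a)%N -> (a + m <= n)%N ->
  absorbs p t (fun l => a < l < a + m)%N W ->
  row_prod t a m * (x a * W) = x (a + m)%N * (row_prod t a m * W) +
    \sum_(j < m) cross (a + m) * (q ^+ (m - j).-1 * (row_prod t a j * W)).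
Proof.
move=> gt_a; elim: m => [|m IH] le_n tW.
  by rewrite addn0 big_ord0 addr0 !mul1r.
rewrite row_prodS -mulrA IH; [|lia|by move=> l lt_l; apply: tW; lia].
rewrite mulrDr mulrA (affine_tx t_affine) -/(cross _); last by lia.
rewrite addnS mulrDl -!mulrA -addrA; congr (_ + _).
rewrite big_ord_recr /= addrC subSnn mul1r; congr (_ + _).
rewrite mulr_sumr; apply: eq_bigr => -[j lt_j] _ /=.
rewrite mulrA t_cross -?mulrA; last by lia.
rewrite (central_mulrCA _ _ (centralX _ qC)) subSn 1?ltnW //=.
rewrite -[(m - j)%N]prednK ?subn_gt0 //.
rewrite exprSr -!mulrA; do 2!congr (_ * _).
rewrite mulrA row_prod_comm => [|l lt_l]; last first.
  apply: commr_sym; apply: commrB; first by apply: (braid_far t_braid); lia.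
  exact/commr_sym/(centralB pC qC).
rewrite -mulrA mulrBl tW; last by lia.
by rewrite -mulrBl opprB addrC subrK (central_mulrCA _ _ qC).
Qed.

Lemma shape_prod_mulx k i mu Z (a := (k - i)%N) (c := nth 0%N mu i) :
  (k <= n)%N -> (i < k)%N -> in_box n k mu ->
  absorbs p t (fun l => (0 < l < a) || (k < l < n))%N Z ->
  shape_prod t 0 mu * (x a * Z) = x (a + c)%N * (shape_prod t 0 mu * Z) +
  \sum_(m < c) cross (a + c) * p ^+ nrows_gt m (drop i.+1 mu) *
    q ^+ (c - m).-1 * (shape_prod t 0 (remove_ribbon i m mu) * Z).
Proof.
move=> le_kn lt_i mu_box tZ; have /and3P[/eqP size_mu mu_le mu_sorted] := mu_box.
have lt_mu : (i < size mu)%N by rewrite size_mu.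
have c_le : (c <= n - k)%N by apply: (all_nthP 0%N mu_le).
set upper := take i mu; set lower := drop i.+1 mu; set W := shape_prod t a upper * Z.
have size_upper : size upper = i by rewrite size_takel // ltnW.
have size_lower : (0 + size lower).+1 = a by rewrite add0n size_drop size_mu subnSK.
have tW : absorbs p t (fun l => (0 < l < a) || (a < l < a + c))%N W.
  exact: (absorbs_shape_prod_take t_braid pC le_kn lt_i mu_box tZ).
have upper_x : shape_prod t a upper * (x a * Z) = x a * W.
  rewrite /W !mulrA; congr (_ * _); apply/commr_sym/(@shape_prod_comm _ _ _ _ _ (n - k)).
    by apply/allP => d /mem_take/(allP mu_le).
  by move=> l; rewrite size_upper => lt_l; apply/commr_sym/(affine_tx_far t_affine); lia.
have lower_x : GRing.comm (shape_prod t 0 lower) (x (a + c)%N).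
  apply/commr_sym/shape_prod_drop_comm => // l; rewrite size_mu => lt_l.
  by apply/commr_sym/(affine_tx_far t_affine); lia.
rewrite (shape_prod_split t 0 lt_mu) size_mu add0n -/a -!mulrA upper_x.
rewrite row_prod_mulx; [|lia|lia|by move=> l lt_l; apply: tW; lia].
rewrite mulrDr mulrA lower_x -!mulrA; congr (_ + _).
rewrite mulr_sumr; apply: eq_bigr => m _.
rewrite mulrA (cross_comm lower_x) -!mulrA; congr (_ * _).
rewrite (central_mulrCA _ _ (centralX _ qC)) -size_lower.
rewrite (@shape_prod_insert _ _ n t_braid p pC _ _ _ (n - k)) ?drop_sorted //; first last.
- by move=> l lt_l; apply: tW; lia.
- by lia.
- by apply/allP => d /mem_drop/(allP mu_le).
rewrite (shape_prod_remove_ribbon t 0 m lt_mu) size_mu add0n -[in RHS]mulrA.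
exact: (central_mulrCA _ _ (centralX _ pC)).
Qed.

End AffineHecke.

(** * Elementary symmetric polynomials *)

Lemma incr_choose_subseq l r s : s \in incr_choose l r -> subseq s l.
Proof.
elim: l r s => [|a l IH] [|r] s //=; rewrite ?inE; try by move/eqP->.
rewrite mem_cat => /orP[/mapP[u /IH sub_u ->]|/IH sub_s]; first by rewrite /= eqxx.
exact: subseq_trans sub_s (subseq_cons l a).
Qed.

Section ElementarySymmetric.
Variables (A : pzRingType) (x : nat -> A).

Definition elsym (l : seq nat) (r : nat) : A :=
  \sum_(s <- incr_choose l r) \prod_(i <- s) x i.

Lemma elsym0 l : elsym l 0 = 1.
Proof. by case: l => [|a l]; rewrite /elsym big_seq1 big_nil. Qed.

Lemma elsym_nil r : elsym [::] r.+1 = 0.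
Proof. by rewrite /elsym big_nil. Qed.

Lemma elsym_cons a l r : elsym (a :: l) r.+1 = x a * elsym l r + elsym l r.+1.
Proof.
rewrite /elsym /= big_cat big_map mulr_sumr; congr (_ + _).
by apply: eq_bigr => s _; rewrite big_cons.
Qed.

Lemma elsym_rcons a l r : elsym (rcons l a) r.+1 = elsym l r * x a + elsym l r.+1.
Proof.
elim: l r => [|b l IH] r /=.
  rewrite elsym_cons !elsym_nil; case: r => [|r]; first by rewrite !elsym0 mulr1 mul1r.
  by rewrite !elsym_nil mulr0 mul0r.
rewrite elsym_cons IH; case: r => [|r].
  by rewrite !elsym_cons !elsym0 mulr1 mul1r addrCA.
by rewrite IH !elsym_cons mulrDr mulrDl !mulrA -!addrA; congr (_ + _); rewrite addrCA.
Qed.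

Lemma elsym_rev l r : elsym (rev l) r = \sum_(s <- incr_choose l r) \prod_(i <- rev s) x i.
Proof.
elim: l r => [|a l IH] [|r].
- by rewrite elsym0 big_seq1 big_nil.
- by rewrite elsym_nil big_nil.
- by rewrite elsym0 big_seq1 big_nil.
rewrite rev_cons elsym_rcons !IH [incr_choose _ _]/= big_cat big_map mulr_suml.
congr (_ + _).
by apply: eq_bigr => s _; rewrite rev_cons -cats1 big_cat big_seq1.
Qed.

Lemma elsym_comm y l r :
  (forall i, i \in l -> GRing.comm y (x i)) -> GRing.comm y (elsym l r).
Proof.
move=> yxC; rewrite /elsym big_seq; apply: commr_sum => s /incr_choose_subseq sub_s.
by rewrite big_seq; apply: commr_prod => i /(mem_subseq sub_s)/yxC.
Qed.

Lemma elsym_comm_pair y a b u l r : (forall i, i \in u ++ l -> GRing.comm y (x i)) ->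
  GRing.comm y (x a + x b) -> GRing.comm y (x a * x b) ->
  GRing.comm y (elsym (u ++ a :: b :: l) r).
Proof.
move=> yxC y_add y_mul; elim: u r yxC => [|c u IH] [|r] yxC.
- by rewrite elsym0; apply: commr1.
- have y_l s : GRing.comm y (elsym l s) by apply: elsym_comm.
  case: r => [|r].
    by rewrite !elsym_cons !elsym0 !mulr1 addrA; apply: commrD.
  have -> : elsym ([::] ++ a :: b :: l) r.+2 =
      x a * x b * elsym l r + ((x a + x b) * elsym l r.+1 + elsym l r.+2).
    by rewrite !elsym_cons mulrDr mulrDl -!addrA mulrA.
  by apply/commrD/commrD => //; apply: commrM.
- by rewrite elsym0; apply: commr1.
rewrite cat_cons elsym_cons.
have yuC i : i \in u ++ l -> GRing.comm y (x i).
  by move=> i_ul; apply: yxC; rewrite inE i_ul orbT.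
apply: commrD; last exact: IH.
by apply: commrM; [apply/yxC/mem_head|apply: IH].
Qed.

End ElementarySymmetric.

Lemma elsym_map (A : pzRingType) (x : nat -> A) (f : nat -> nat) l r :
  elsym x (map f l) r = elsym (x \o f) l r.
Proof.
elim: l r => [|a l IH] [|r] /=; rewrite ?elsym0 ?elsym_nil //.
by rewrite !elsym_cons !IH.
Qed.

Lemma elem_sym_rev (A : pzRingType) (x : nat -> A) k r : elem_sym x k r =
  \sum_(s <- incr_choose (iota 1 k) r) \prod_(i <- rev s) x (k.+1 - i)%N.
Proof.
rewrite -(elsym_rev (fun i => x (k.+1 - i)%N)) -[RHS](elsym_map x (fun i => k.+1 - i)%N).
congr elsym; apply: (@eq_from_nth _ 0%N) => [|i].
  by rewrite size_map size_rev !size_iota.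
rewrite size_iota => lt_i.
by rewrite (nth_map 0%N) ?size_rev ?size_iota // nth_rev ?size_iota // !nth_iota; lia.
Qed.

Section AffineElementarySymmetric.
Variables (A : pzRingType) (n : nat) (p q hb : A) (t x : nat -> A).
Hypothesis t_affine : affine_hecke_relations n p q hb t x.

Lemma t_comm_addx i : (0 < i < n)%N -> GRing.comm (t i) (x i + x i.+1).
Proof.
move=> lt_i; rewrite /GRing.comm mulrDr (affine_tx t_affine) // (affine_txS t_affine) //.
by rewrite addrACA subrr addr0 -mulrDl addrC.
Qed.

Lemma t_comm_mulx i : (0 < i < n)%N -> GRing.comm (t i) (x i * x i.+1).
Proof.
move=> lt_i; have crossC := cross_comm t_affine (commr_refl (x i.+1)).
rewrite /GRing.comm mulrA (affine_tx t_affine) // -/(cross _ _ _ _ _) mulrDl -crossC -mulrA.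
rewrite (affine_txS t_affine) // mulrBr subrK mulrA.
by rewrite (affine_xC t_affine (i := i.+1)) //; lia.
Qed.

Lemma t_comm_elem_sym k r l : (k <= n)%N -> (0 < l < n)%N -> l != k ->
  GRing.comm (t l) (elem_sym x k r).
Proof.
move=> le_kn lt_l ne_k; rewrite -[elem_sym x k r]/(elsym x (iota 1 k) r).
have [lt_k|ge_k] := ltnP l k; last first.
  by apply: elsym_comm => i; rewrite mem_iota => lt_i; apply: (affine_tx_far t_affine); lia.
rewrite (@iota1_split l k); last by lia.
apply: elsym_comm_pair; [|exact: t_comm_addx|exact: t_comm_mulx].
by move=> i; rewrite mem_cat !mem_iota => i_l; apply: (affine_tx_far t_affine); lia.
Qed.

End AffineElementarySymmetric.

(** * Composing the operators *)

Section Composition.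
Variables (H : algType rat) (n k : nat) (p q hb : H) (t x : nat -> H).
Hypotheses (le_kn : (k <= n)%N) (t_affine : affine_hecke_relations n p q hb t x).
Implicit Types (L : seq (H * seq nat)) (Z : H).
Let D := Dop p q n k hb x.

Definition shape_eval (Z : H) (L : seq (H * seq nat)) : H :=
  \sum_(gm <- L) gm.1 * (shape_prod t 0 gm.2 * Z).

Lemma Dop_in_box i L :
  all (fun gm => in_box n k gm.2) L -> all (fun gm => in_box n k gm.2) (D i L).
Proof.
move/allP => L_box; apply/allP => gm /flattenP[l /mapP[gl /L_box gl_box ->]].
rewrite in_cons => /orP[/eqP-> //|/mapP[lam]].
by rewrite mem_filter mem_boxparts => /andP[_ lam_box] ->.
Qed.

Lemma foldr_Dop_in_box mu s : in_box n k mu ->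
  all (fun gm => in_box n k gm.2) (foldr D [:: (1, mu)] s).
Proof. by move=> mu_box; elim: s => [|i s IH]; [rewrite /= mu_box | apply: Dop_in_box]. Qed.

Lemma shape_eval_Dop i L Z : (i < k)%N -> all (fun gm => in_box n k gm.2) L ->
  absorbs p t (fun l => (0 < l < k - i) || (k < l < n))%N Z ->
  shape_eval Z (D i.+1 L) = shape_eval (x (k - i)%N * Z) L.
Proof.
move=> lt_i /allP L_box tZ; rewrite /shape_eval /D /Dop big_flatten big_map.
apply: eq_big_seq => -[g mu] /L_box /= mu_box; have [size_mu _] := in_boxP _ _ _ mu_box.
rewrite (shape_prod_mulx t_affine le_kn lt_i mu_box tZ) big_cons /=.
rewrite (_ : nth 0 mu i + k.+1 - i.+1 = k - i + nth 0 mu i)%N; last by lia.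
rewrite big_map (perm_big _ (perm_ribbons i mu_box)) big_map /= mulrDr -mulrA.
congr (_ + _).
rewrite -[X in iota 0 X]subn0 -/(index_iota _ _) big_mkord mulr_sumr; apply: eq_bigr => m _.
have mu_sorted : sorted geq mu by case/and3P: mu_box.
rewrite ribbon_ht_remove_ribbon ?ribbon_wd_remove_ribbon ?size_mu ?ltn_ord //=.
by rewrite !mulrA.
Qed.

(* The operators are applied from the bottom row up, so the variables [x (k.+1 - i)]
   next to [Z] commute with the letters that are still to be absorbed. *)
Lemma shape_eval_foldr_Dop mu s i0 Z : in_box n k mu -> path ltn i0 s ->
  all (fun i => i <= k)%N s -> absorbs p t (fun l => (0 < l < k - i0) || (k < l < n))%N Z ->
  shape_eval Z (foldr D [:: (1, mu)] s) =
  shape_prod t 0 mu * (\prod_(i <- rev s) x (k.+1 - i)%N * Z).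
Proof.
move=> mu_box; elim: s i0 Z => [|i s IH] i0 Z.
  by move=> _ _ _; rewrite /shape_eval big_seq1 big_nil !mul1r.
case: i => [|i] //= /andP[lt_i s_path] /andP[le_i s_le] tZ.
rewrite shape_eval_Dop //; first last.
- by move=> l lt_l; apply: tZ; lia.
- exact: foldr_Dop_in_box.
rewrite (IH i.+1) //; first by rewrite rev_cons -cats1 big_cat big_seq1 subSS mulrA.
apply: absorbs_mul => [|l lt_l|l lt_l]; first exact: hecke_p_central t_affine.
  by apply/commr_sym/(affine_tx_far t_affine); lia.
by apply: tZ; lia.
Qed.

End Composition.

(** * The shifted generators *)

Lemma braid_addr (A : pzRingType) (a b c d : A) : central c ->
  a * a + c * a = d -> b * b + c * b = d -> a * b * a = b * a * b ->
  (a + c) * (b + c) * (a + c) = (b + c) * (a + c) * (b + c).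
Proof.
move=> cC quad_a quad_b braid_ab.
have expand u v : (u + c) * (v + c) * (u + c) = u * v * u +
    (c * (u * v + v * u) + c * (u * u + c * u) + c * c * (u + v) + c * c * c).
  rewrite !(mulrDl, mulrDr) -!mulrA -?(cC u) -?(cC v) -?(cC (v * c)).
  rewrite ?(central_mulrCA _ _ cC) -?(cC u) -?(cC v).
  by rewrite !addrA [LHS](ACl (1*5*3*2*4*6*7*8)).
by rewrite !expand quad_a quad_b braid_ab [b * a + _]addrC [b + a]addrC.
Qed.

Section ShiftedGenerators.
Variables (H : algType rat) (n : nat) (p q hb : H) (T x : nat -> H).
Hypotheses (pC : central p) (qC : central q) (hbC : central hb).
Hypothesis T_quad : forall i, (0 < i < n)%N -> (T i + p) * (T i - q) = 0.
Hypothesis T_braid : forall i, (0 < i)%N -> (i.+1 < n)%N ->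
  T i * T i.+1 * T i = T i.+1 * T i * T i.+1.
Hypothesis T_far : forall i j, (0 < i < n)%N -> (0 < j < n)%N -> (i.+1 < j)%N ->
  T i * T j = T j * T i.
Let pqC : central (p - q) := centralB pC qC.
Let t := Tbar p q T.

Lemma Tbar_comm y i : GRing.comm y (T i) -> GRing.comm y (t i).
Proof. by move=> yTC; apply: commrD => //; apply/commr_sym/pqC. Qed.

Lemma Tbar_braid_relations : braid_relations n t.
Proof.
have T_sqr i : (0 < i < n)%N -> T i * T i + (p - q) * T i = p * q.
  move/T_quad; rewrite mulrDl !mulrBr -(qC (T i)) addrA => /subr0_eq <-.
  by rewrite mulrBl [p * T i - _]addrC addrA.
split=> [i gt_i lt_i|i j gt_i lt_j].
  by apply: (braid_addr (d := p * q) pqC); [apply: T_sqr|apply: T_sqr|exact: T_braid]; lia.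
by apply/Tbar_comm/commr_sym/Tbar_comm/commr_sym/T_far; lia.
Qed.

Lemma Tbar_hecke_relations : hecke_relations n p q t.
Proof.
split=> // [|i /T_quad quad_i]; first exact: Tbar_braid_relations.
have -> : t i - p = T i - q by rewrite -addrA (addrAC p) subrr add0r.
have -> : t i + q = T i + p by rewrite -addrA subrK.
rewrite -[RHS]quad_i; apply: commrD; last exact/commr_sym/pC.
by apply/commr_sym/commrB => //; apply/commr_sym/qC.
Qed.

Hypothesis xC : forall i j, (0 < i <= n)%N -> (0 < j <= n)%N -> x i * x j = x j * x i.
Hypothesis Tx_far : forall i j, (0 < i < n)%N -> (0 < j <= n)%N -> j != i -> j != i.+1 ->
  T i * x j = x j * T i.
Hypothesis Tx : forall i, (0 < i < n)%N -> T i * x i = x i.+1 * T i + (hb - (p - q) * x i).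
Hypothesis TxS : forall i, (0 < i < n)%N -> T i * x i.+1 = x i * T i - (hb - (p - q) * x i).

Lemma Tbar_affine_hecke_relations : affine_hecke_relations n p q hb t x.
Proof.
split=> // [|i j lt_i lt_j ne_i ne_iS|i lt_i|i lt_i]; first exact: Tbar_hecke_relations.
- exact/commr_sym/Tbar_comm/commr_sym/Tx_far.
- rewrite mulrDl mulrDr Tx // (pqC (x i.+1)) -!addrA; congr (_ + _).
  by rewrite addNr addr0 addrCA subrr addr0.
rewrite mulrDl mulrDr TxS // !opprB (pqC (x i)) -!addrA; congr (_ + (_ + _)).
exact: addrC.
Qed.

End ShiftedGenerators.

Lemma central_qfact (H : algType rat) (p q : H) m :
  central p -> central q -> central (qfact p q m).
Proof.
move=> pC qC; apply: central_prod => i _; apply: central_sum => j _.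
exact: centralM (centralX _ pC) (centralX _ qC).
Qed.

Section Sigma.
Variables (H : algType rat) (n k : nat) (p q cinv : H) (T : nat -> H).
Let t := Tbar p q T.
Let Sigma_nk := Sigma p q T cinv n k.
Hypotheses (le_kn : (k <= n)%N) (cinvC : central cinv) (t_hecke : hecke_relations n p q t).

Lemma SigmaE : Sigma_nk = cinv * young_sym n q t k.
Proof. by rewrite /young_sym /qlen_sum big_allpairs_dep. Qed.

Lemma absorbs_Sigma : absorbs p t (fun l => (0 < l < n) && (l != k))%N Sigma_nk.
Proof.
rewrite SigmaE; apply: absorbs_mul => [|l _|].
- exact: hecke_p_central t_hecke.
- exact: cinvC.
exact: absorbs_young_sym.
Qed.

Lemma Sigma_comm y : (forall l, (0 < l < n)%N -> l != k -> GRing.comm y (t l)) ->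
  GRing.comm y Sigma_nk.
Proof.
move=> ytC; rewrite SigmaE; apply: commrM (young_sym_comm t_hecke le_kn ytC).
exact/commr_sym/cinvC.
Qed.

Lemma Tnu_shape_prod nu :
  in_box n k nu -> Tnu p q T cinv n k nu = shape_prod t 0 nu * Sigma_nk.
Proof. by move=> nu_box; rewrite -(prod_red_wnu t_hecke le_kn nu_box). Qed.

Lemma evalc_shape_eval L : all (fun gm => in_box n k gm.2) L ->
  evalc p q T cinv n k L = shape_eval t Sigma_nk L.
Proof.
by move=> /allP L_box; apply: eq_big_seq => gm /L_box gm_box; rewrite Tnu_shape_prod.
Qed.

End Sigma.

Theorem theorem5p2 (H : algType rat) (n k : nat)
  (p q hb : H) (T x : nat -> H) (cinv : H)
  (Hkn : (k <= n)%N)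
  (Hpc : forall y : H, p * y = y * p)
  (Hqc : forall y : H, q * y = y * q)
  (Hhc : forall y : H, hb * y = y * hb)
  (Hquad : forall i, (1 <= i < n)%N -> (T i + p) * (T i - q) = 0)
  (Hbraid : forall i, (1 <= i)%N -> (i.+1 < n)%N ->
              T i * T i.+1 * T i = T i.+1 * T i * T i.+1)
  (Hfar : forall i j, (1 <= i < n)%N -> (1 <= j < n)%N -> (i.+1 < j)%N ->
              T i * T j = T j * T i)
  (Hxx : forall i j, (1 <= i <= n)%N -> (1 <= j <= n)%N -> x i * x j = x j * x i)
  (HTx : forall i j, (1 <= i < n)%N -> (1 <= j <= n)%N -> j != i -> j != i.+1 ->
              T i * x j = x j * T i)
  (HTxi : forall i, (1 <= i < n)%N ->
              T i * x i = x i.+1 * T i + (hb - (p - q) * x i))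
  (HTxi1 : forall i, (1 <= i < n)%N ->
              T i * x i.+1 = x i * T i - (hb - (p - q) * x i))
  (Hcinv : cinv * (qfact p q k * qfact p q (n - k)) = 1)
  (Hcinv' : (qfact p q k * qfact p q (n - k)) * cinv = 1)
  (mu : seq nat) (Hmu : in_box n k mu) (r : nat) (Hr : (r <= k)%N) :
  Tnu p q T cinv n k mu * elem_sym x k r =
  \sum_(s <- incr_choose (iota 1 k) r)
     evalc p q T cinv n k (foldr (Dop p q n k hb x) [:: (1, mu)] s).
Proof.
have t_affine :=
  Tbar_affine_hecke_relations Hpc Hqc Hhc Hquad Hbraid Hfar Hxx HTx HTxi HTxi1.
have cinvC : central cinv.
  by apply: central_inv Hcinv Hcinv'; apply: centralM; apply: central_qfact.
have Sigma_absorbs := absorbs_Sigma Hkn cinvC t_affine.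
have Sigma_e : GRing.comm (elem_sym x k r) (Sigma p q T cinv n k).
  apply: (Sigma_comm Hkn cinvC t_affine) => l lt_l ne_k.
  exact/commr_sym/(t_comm_elem_sym t_affine).
rewrite (Tnu_shape_prod cinv Hkn t_affine) // -mulrA -Sigma_e elem_sym_rev.
rewrite mulr_suml mulr_sumr.
apply: eq_big_seq => s /incr_choose_subseq sub_s.
rewrite (evalc_shape_eval cinv Hkn t_affine); last exact: foldr_Dop_in_box.
rewrite (shape_eval_foldr_Dop Hkn t_affine (i0 := 0)) //.
- by apply: (subseq_path _ sub_s); [exact: ltn_trans|exact: (iota_ltn_sorted 0 k.+1)].
- by apply/allP => i /(mem_subseq sub_s); rewrite mem_iota; lia.
by move=> l lt_l; apply: Sigma_absorbs; lia.
Qed.
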